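(* Let $T$ be a bounded linear operator on a complex Hilbert space $\mathcal{H}$ such that $W_s(T)$ has non-empty interior, and let $\lambda\in\partial W_s(T)$. (a) If $\lambda$ is either a point of infinite curvature or a point of infinite one-sided curvature of $\partial W_s(T)$, then $\lambda\in R(T)$. (b) If $\lambda$ is a point of infinite one-sided curvature of $\partial W_s(T)$ but is not a linear vertex of $W_s(T)$, then $\lambda\in R_e(T)$. (c) If $\lambda$ is a point of infinite curvature of $\partial W_s(T)$ but is not a linear vertex of $W(T)$, then $\lambda$ is a normal essential eigenvalue of $T$.
   Context: The numerical range is $W(T)=\{\langle Tx,x\rangle : x\in\mathcal{H},\ \|x\|=1\}$. The state numerical range is $W_s(T)=\{\phi(T):\phi\in S(C^*(T))\}$, where $C^*(T)$ is the $C^*$-algebra generated by $T$ and the identity $I$, and $S(\mathcal{A})$ is the state space of $\mathcal{A}$. One has $W_s(T)=\overline{W(T)}$, a compact convex set; $W(T)$ is convex. Let $C\subset\mathbb{C}$ be convex with non-empty interior. $C$ is in standard position (with respect to the boundary point $0\in\partial C$) if $C$ is contained in the closed upper half-plane $\{\operatorname{Im}\alpha\ge 0\}$. A point $\lambda\in\partial C$ is of infinite curvature if, after a suitable rotation and translation taking $\lambda$ to $0$ and putting $C$ in standard position, $$\lim_{\alpha\to 0,\ \alpha\in C}\frac{|\operatorname{Im}\alpha|}{(\operatorname{Re}\alpha)^2}=\infty .$$ If $C$ is so placed in standard position and the real axis is the only tangent (i.e. supporting) line to $\partial C$ at $0$, then the point is of infinite lefthand curvature if $\frac{|\operatorname{Im}\alpha|}{(\operatorname{Re}\alpha)^2}\to\infty$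 as $\alpha\to 0$ with $\alpha\in C$, $\operatorname{Re}\alpha<0$, and of infinite righthand curvature if the same holds with $\operatorname{Re}\alpha>0$. It is of infinite one-sided curvature if it is of infinite lefthand or infinite righthand curvature. In these limits $\alpha\ne0$, and the quotient is read as $+\infty$ when $\operatorname{Re}\alpha=0\neq\operatorname{Im}\alpha$. A point $\lambda\in\partial C$ is a linear vertex of $C$ if $C$ is the convex hull of $\{\lambda\}\cup C'$ for some convex set $C'$ with $\lambda\notin\overline{C'}$. $R(T)$ (reducing approximate eigenvalues) is the set of $\lambda\in\mathbb{C}$ for which there is a sequence $(u_n)$ of unit vectors with $\|(T-\lambda I)u_n\|+\|(T^*-\overline{\lambda}I)u_n\|\to 0$. $R_e(T)$ (reducing essential eigenvalues) is the set of $\lambda$ for which such a sequence exists that moreover tends weakly to zero. $\lambda$ is a normal essential eigenvalue of $T$ if $\lambda\in R_e(T)$ and every orthonormal sequence $(u_n)$ with $\|(T-\lambda I)u_n\|\to 0$ also satisfies $\|(T^*-\overline{\lambda}I)u_n\|\to 0$. *)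

(* Defs.v *)
From HB Require Import structures.
From mathcomp Require Import all_boot all_order all_algebra.
From mathcomp Require Import all_classical all_reals all_analysis.
From mathcomp Require Export complex.

Set Implicit Arguments.
Unset Strict Implicit.
Unset Printing Implicit Defensive.

Import Order.TTheory GRing.Theory Num.Theory.
Import numFieldNormedType.Exports.

Local Open Scope classical_set_scope.
Local Open Scope ring_scope.

(* The norm topology on R[i], the same as that of the numFieldType R[i].      *)
HB.instance Definition _ (R : rcfType) := Pointed.copy R[i] R[i]^o.
HB.instance Definition _ (R : rcfType) := NormedModule.copy R[i] R[i]^o.

(* The norm of a normedModType over R[i] takes its values in R[i], where      *)
(* 0 <= z says that z is real and nonnegative.  The inner product is linear   *)
(* in its first argument.                                                     *)
HB.mixin Record isHilbert (R : realType) H of CompleteNormedModule R[i] H := {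
  inner : {dot H for @Num.conj R[i]};
  inner_norm : forall x : H, inner x x = `|x| ^+ 2
}.

#[short(type="hilbertType")]
HB.structure Definition Hilbert (R : realType) :=
  {H of CompleteNormedModule R[i] H & isHilbert R H}.

Section Operators.
Variables (R : realType) (H : hilbertType R).
Implicit Types (A B T : H -> H) (S : set (H -> H)) (phi : (H -> H) -> R[i]).
Implicit Types (u : nat -> H) (lambda : R[i]).

Definition bounded_operator A : Prop :=
  linear A /\ exists M : R[i], forall x, `|A x| <= M * `|x|.

(* By the Riesz representation theorem, a bounded operator A has exactly one  *)
(* adjoint, so that the default value of get plays no role for such A.        *)
Definition adjoint A : H -> H :=
  get [set B : H -> H | forall x y, inner (A x) y = inner x (B y)].

Record unital_cstar_subalgebra S : Prop := {
  cstar_bounded : S `<=` bounded_operator ;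
  cstar_id : S id ;
  cstar_linear : forall (a : R[i]) A B,
    S A -> S B -> S (fun x => a *: A x + B x) ;
  cstar_comp : forall A B, S A -> S B -> S (A \o B) ;
  cstar_adjoint : forall A, S A -> S (adjoint A) ;
  (* S is closed for the operator norm *)
  cstar_closed : forall A, bounded_operator A ->
    (forall e : R[i], 0 < e ->
      exists2 B, S B & forall x, `|A x - B x| <= e * `|x|) -> S A
}.

Definition generated_cstar_algebra T : set (H -> H) :=
  smallest unital_cstar_subalgebra [set T].

(* phi represents a functional on S: its values outside S are irrelevant. For *)
(* a positive functional on a unital C*-algebra, norm 1 means phi id = 1.     *)
Record state S phi : Prop := {
  state_linear : forall (a : R[i]) A B, S A -> S B ->
    phi (fun x => a *: A x + B x) = a * phi A + phi B ;
  state_positive : forall A, S A -> 0 <= phi (adjoint A \o A) ;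
  state_unital : phi id = 1
}.

Definition numerical_range T : set R[i] :=
  [set inner (T x) x | x in [set x | `|x| = 1]].

Definition state_numerical_range T : set R[i] :=
  [set phi T | phi in state (generated_cstar_algebra T)].

Definition unit_vectors u : Prop := forall n, `|u n| = 1.

Definition orthonormal_sequence u : Prop :=
  forall m n, inner (u m) (u n) = (m == n)%:R.

(* Convergence in the weak topology, by the Riesz representation theorem.     *)
Definition weakly_to_zero u : Prop :=
  forall y, inner (u n) y @[n --> \oo] --> (0 : R[i]).

Definition reducing_approx_eigenvalue T : set R[i] :=
  [set lambda | exists2 u, unit_vectors u &
    `|T (u n) - lambda *: u n| + `|adjoint T (u n) - lambda^* *: u n|
      @[n --> \oo] --> (0 : R[i])].

Definition reducing_essential_eigenvalue T : set R[i] :=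
  [set lambda | exists u, [/\ unit_vectors u, weakly_to_zero u &
    `|T (u n) - lambda *: u n| + `|adjoint T (u n) - lambda^* *: u n|
      @[n --> \oo] --> (0 : R[i])]].

Definition normal_essential_eigenvalue T : set R[i] :=
  [set lambda | reducing_essential_eigenvalue T lambda /\
    forall u, orthonormal_sequence u ->
      `|T (u n) - lambda *: u n| @[n --> \oo] --> (0 : R[i]) ->
      `|adjoint T (u n) - lambda^* *: u n| @[n --> \oo] --> (0 : R[i])].

End Operators.

Section PlaneConvexSets.
Variable R : realType.
Implicit Types (C D L : set R[i]) (lambda omega a : R[i]).

Definition boundary C : set R[i] := closure C `\` C°.

(* Rcomplex R is R[i] as a real vector space, so that the weights of convex   *)
(* combinations are real.                                                     *)
Definition convex C : Prop := @convex_set R (Rcomplex R) C.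

Definition convex_hull C : set R[i] := smallest convex C.

Definition linear_vertex C lambda : Prop :=
  boundary C lambda /\
  exists C', [/\ convex C', ~ closure C' lambda &
                 C = convex_hull ([set lambda] `|` C')].

(* The image of C under the translation taking lambda to 0 followed by the    *)
(* rotation with factor omega, where |omega| = 1.                             *)
Definition rigid_motion lambda omega C : set R[i] :=
  [set omega * (z - lambda) | z in C].

(* complex.Re and complex.Im take values in R; 'Re and 'Im (which Re and Im   *)
(* abbreviate here) would take values in R[i].                                *)
Definition standard_position D : Prop :=
  boundary D 0 /\ D `<=` [set z | 0 <= complex.Im z].

(* L is a supporting line of D at 0: a line through 0 with D in one of its    *)
(* closed half-planes (replacing eta by - eta exchanges the half-planes).     *)
Definition tangent_line D L : Prop :=
  exists eta : R[i], [/\ `|eta| = 1, L = [set z | complex.Im (eta * z) = 0] &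
                         D `<=` [set z | 0 <= complex.Im (eta * z)]].

Definition real_axis : set R[i] := [set z | complex.Im z = 0].

(* The value +oo is meant for Re a = 0 with Im a != 0: in the limits below,   *)
(* a = 0 is excluded by the punctured neighborhoods 0^'.   *)
Definition curvature_ratio a : \bar R :=
  if complex.Re a == 0 then +oo%E
  else (`|complex.Im a| / complex.Re a ^+ 2)%:E.

Definition infinite_curvature C lambda : Prop :=
  exists omega, `|omega| = 1 /\
    let D := rigid_motion lambda omega C in
    standard_position D /\
    curvature_ratio a @[a --> within D 0^'] --> +oo%E.

Definition infinite_lefthand_curvature D : Prop :=
  curvature_ratio a @[a --> within (D `&` [set z | complex.Re z < 0]) 0^']
    --> +oo%E.

Definition infinite_righthand_curvature D : Prop :=
  curvature_ratio a @[a --> within (D `&` [set z | 0 < complex.Re z]) 0^']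
    --> +oo%E.

Definition infinite_one_sided_curvature C lambda : Prop :=
  exists omega, `|omega| = 1 /\
    let D := rigid_motion lambda omega C in
    [/\ standard_position D,
        forall L, tangent_line D L -> L = real_axis &
        infinite_lefthand_curvature D \/ infinite_righthand_curvature D].

End PlaneConvexSets.

(* Main.v *)
Require Import Defs.
From mathcomp Require Import all_boot all_order all_algebra.
From mathcomp Require Import all_classical all_reals all_analysis.
From mathcomp Require Import ring lra.
Import Order.TTheory GRing.Theory Num.Theory.
Import numFieldNormedType.Exports.
Local Open Scope classical_set_scope.
Local Open Scope ring_scope.

(** Throughout, D(x) denotes |(T - lambda) x| + |(T^* - conj(lambda)) x|.

    The state range equals the closure of the numerical range W(T).  A state is
    nonnegative on every positive self-adjoint element, because 1 - A has a
    square root inside the algebra when |A| < 1; hence its value at T lies in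
    every half-plane containing the convex set W(T) (state_range_sub_closure).
    Conversely an ultrafilter limit of vector states is a state
    (closure_sub_state_range).

    The analytic core is defect_gap: at a point of infinite curvature, possibly
    one-sided, unit vectors x with <T x, x> close to lambda have D(x) small.
    After a rigid motion write T = A + iB with A, B self-adjoint and B >= 0.  If
    <T x, x> is nearly 0, then B x is nearly 0 since |B x|^2 <= |B| <B x, x>.  If
    A x were not small, the vectors x + t A x or x - t A x would have numerical
    values whose real part is of order t on a prescribed side and whose
    imaginary part is only O(t^2), so the ratio Im / Re^2 would stay bounded
    along points of the range tending to 0 (test_vector, curvature_gap).
    Applied to a sequence with <T x_n, x_n> -> lambda this is the first assertion.
    Applied to orthonormal sequences it is the second half of normal essentiality.

    For the essential part, consider whether D is bounded below on the
    orthogonal complement of some finite set of vectors.  If it never is, an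
    inductive choice gives an orthonormal, hence weakly null, sequence along
    which D tends to 0, and lambda is a reducing essential eigenvalue.  If it is,
    an exchange argument (exchange, bounded_below_kernel) replaces the finite set
    by one inside the joint kernel of T - lambda and T^* - conj(lambda).  The
    orthogonal complement of this finite set reduces T, and by defect_gap lambda
    is not in the closure of the range W' of the restriction of T.  Splitting
    vectors shows that every point of W(T) lies on a segment from lambda to a
    point of W', so that lambda is a linear vertex of W(T), and likewise of its
    closure, against the hypotheses of the last two assertions. *)

Set Implicit Arguments.
Unset Strict Implicit.
Unset Printing Implicit Defensive.

Local Notation re := complex.Re.
Local Notation im := complex.Im.
Local Notation "x %:C" := (real_complex _ x) : ring_scope.

(** * Real-valued norms and the real inner product *)
Section RealNorm.
Variables (R : realType) (V : normedModType R[i]).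
Implicit Types (x y : V) (a : R[i]).

(** Norms take their values in R[i], where the order is partial; all estimates
    are carried out with this real representative. *)
Definition nm x : R := re `|x|.

Lemma nmE x : `|x| = (nm x)%:C.
Proof.
by rewrite /nm; have := normr_ge0 x; case: `|x| => u v; rewrite lecE /= => /andP[/eqP -> _].
Qed.

Lemma nm_ge0 x : 0 <= nm x.
Proof. by have := normr_ge0 x; rewrite nmE ler0c. Qed.

Lemma nmD x y : nm (x + y) <= nm x + nm y.
Proof. by have := ler_normD x y; rewrite !nmE -rmorphD lecR. Qed.

Lemma nmN x : nm (- x) = nm x.
Proof. by rewrite /nm normrN. Qed.

Lemma nmBC x y : nm (x - y) = nm (y - x).
Proof. by rewrite -nmN opprB. Qed.

Lemma nm0 : nm (0 : V) = 0.
Proof. by rewrite /nm normr0. Qed.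

Lemma nm_eq0 x : nm x = 0 -> x = 0.
Proof. by move=> h; apply/normr0_eq0; rewrite nmE h. Qed.

End RealNorm.

Section RealNormC.
Variables (R : realType) (V : normedModType R[i]).
Implicit Types (x y : V) (a b z : R[i]).

Lemma nmZ a x : nm (a *: x) = nm a * nm x.
Proof. by have := normrZ a x; rewrite !nmE -rmorphM => /complexI. Qed.

Lemma nmM a b : nm (a * b) = nm a * nm b.
Proof. by have := normrM a b; rewrite !nmE -rmorphM => /complexI. Qed.

Lemma nm_sqr z : nm z ^+ 2 = re z ^+ 2 + im z ^+ 2.
Proof. by apply: complexI; rewrite rmorphXn /= -nmE add_Re2_Im2. Qed.

Lemma nm_conj z : nm z^* = nm z.
Proof. by rewrite /nm norm_conjC. Qed.

Lemma nmC (r : R) : nm r%:C = `|r|.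
Proof.
by apply: (@pexpIrn _ 2); rewrite ?nnegrE ?nm_ge0 // nm_sqr /= expr0n addr0 real_normK ?num_real.
Qed.

Lemma reN z : re (- z) = - re z. Proof. by case: z. Qed.
Lemma imN z : im (- z) = - im z. Proof. by case: z. Qed.
Lemma reD z a : re (z + a) = re z + re a. Proof. by case: z; case: a. Qed.
Lemma imD z a : im (z + a) = im z + im a. Proof. by case: z; case: a. Qed.
Lemma reM z a : re (z * a) = re z * re a - im z * im a. Proof. by case: z; case: a. Qed.
Lemma imM z a : im (z * a) = re z * im a + im z * re a. Proof. by case: z; case: a. Qed.
Lemma reJ z : re z^* = re z. Proof. by case: z. Qed.
Lemma imJ z : im z^* = - im z. Proof. by case: z. Qed.
Lemma complex_eq z a : re z = re a -> im z = im a -> z = a.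
Proof. by case: z; case: a => /= ? ? ? ? -> ->. Qed.

Lemma re_le z : `|re z| <= nm z.
Proof. by have := normc_ge_Re z; rewrite nmE lecR. Qed.

Lemma im_le z : `|im z| <= nm z.
Proof.
rewrite -(@ler_pXn2r _ 2) ?nnegrE ?nm_ge0 // nm_sqr real_normK ?num_real //.
by rewrite lerDr sqr_ge0.
Qed.

Lemma nm_le_reim z : nm z <= `|re z| + `|im z|.
Proof.
rewrite -(@ler_pXn2r _ 2) ?nnegrE ?nm_ge0 ?addr_ge0 // nm_sqr sqrrD !real_normK ?num_real //.
have := mulr_ge0 (normr_ge0 (re z)) (normr_ge0 (im z)); lra.
Qed.

End RealNormC.

Section Topology.
Variables (R : realType) (V : normedModType R[i]).

Lemma cvg_nmP (T : Type) (F : set_system T) (FF : Filter F) (f : T -> V) (l : V) :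
  f @ F --> l <-> forall e : R, 0 < e -> \forall t \near F, nm (f t - l) < e.
Proof.
split.
  move=> /cvgrPdist_lt h e e0.
  have := h e%:C; rewrite ltcR => /(_ e0); apply: filterS => t.
  by rewrite nmE ltcR nmBC.
move=> h; apply/cvgrPdist_lt => e; rewrite ltcE /= => /andP[/eqP ie re0].
have := h _ re0; apply: filterS => t ht.
by rewrite nmE ltcE /= -ie eqxx nmBC.
Qed.

Lemma cvg_seqP (f : nat -> V) (l : V) :
  f n @[n --> \oo] --> l <->
  forall e : R, 0 < e -> exists N, forall n, (N <= n)%N -> nm (f n - l) < e.
Proof.
rewrite cvg_nmP; split=> h e /h.
  by case=> N _ hN; exists N.
by case=> N hN; exists N.
Qed.

Lemma nbhs_nmP (l : V) (A : set V) :
  nbhs l A <-> exists2 e : R, 0 < e & forall x, nm (x - l) < e -> A x.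
Proof.
split.
  move=> /nbhs_normP[e /=]; rewrite ltcE /= => /andP[/eqP ie e0] h.
  exists (re e) => // x hx; apply: h => /=.
  by rewrite nmE ltcE /= -ie eqxx nmBC.
case=> e e0 h; apply/nbhs_normP; exists e%:C => /=; first by rewrite ltcR.
by move=> x /=; rewrite /ball_ nmE ltcR nmBC => /h.
Qed.

Lemma closure_nmP (A : set V) (l : V) :
  closure A l <-> forall e : R, 0 < e -> exists2 x, A x & nm (x - l) < e.
Proof.
split.
  move=> cl e e0.
  have [|x [Ax hx]] := cl [set x | nm (x - l) < e].
    by apply/nbhs_nmP; exists e.
  by exists x.
move=> h B /nbhs_nmP[e e0 hB]; have [x Ax hx] := h _ e0.
by exists x; split => //; exact: hB.
Qed.

End Topology.

Lemma cauchy_seq_nm (R : realType) (V : completeNormedModType R[i]) (f : nat -> V) :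
  (forall e : R, 0 < e -> exists N, forall m n, (N <= m)%N -> (N <= n)%N ->
     nm (f m - f n) < e) ->
  exists l, forall e : R, 0 < e -> exists N, forall n, (N <= n)%N -> nm (f n - l) < e.
Proof.
move=> h; suff /cvg_ex[l fl] : cvg (f n @[n --> \oo]).
  by exists l; apply/cvg_seqP.
apply/cauchy_cvgP/cauchy_exP => e; rewrite ltcE /= => /andP[/eqP ie e0].
have [N hN] := h _ e0; exists (f N), N => // n Nn.
by rewrite -ball_normE /ball_ /= nmE ltcE /= -ie eqxx /= hN.
Qed.

Section InnerProduct.
Variables (R : realType) (H : hilbertType R).
Implicit Types (x y z : H) (a : R[i]) (r : R).

(** The real inner product of the underlying real Hilbert space. *)
Definition rip x y : R := re (inner x y).

Lemma innerDl x y z : inner (x + y) z = inner x z + inner y z.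
Proof. exact: linearDl. Qed.
Lemma innerDr x y z : inner z (x + y) = inner z x + inner z y.
Proof. exact: linearDr. Qed.
Lemma innerZl a x y : inner (a *: x) y = a * inner x y.
Proof. exact: linearZl_LR. Qed.
Lemma innerZr a x y : inner x (a *: y) = a^* * inner x y.
Proof. exact: linearZr_LR. Qed.
Lemma innerC x y : inner x y = (inner y x)^*.
Proof. by rewrite (hermC inner) expr0 mul1r. Qed.

Lemma rip_nm x : rip x x = nm x ^+ 2.
Proof. by rewrite /rip inner_norm nmE -rmorphXn. Qed.

Lemma ripC x y : rip x y = rip y x.
Proof. by rewrite /rip innerC reJ. Qed.
Lemma ripDl x y z : rip (x + y) z = rip x z + rip y z.
Proof. by rewrite /rip innerDl reD. Qed.
Lemma ripDr x y z : rip z (x + y) = rip z x + rip z y.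
Proof. by rewrite !(ripC z) ripDl. Qed.
Lemma ripZl r x y : rip (r%:C *: x) y = r * rip x y.
Proof. by rewrite /rip innerZl reM /= mul0r subr0. Qed.
Lemma ripZr r x y : rip x (r%:C *: y) = r * rip x y.
Proof. by rewrite !(ripC x) ripZl. Qed.
Lemma ripNl x y : rip (- x) y = - rip x y.
Proof. by rewrite -scaleN1r -[-1](rmorphN1 (real_complex R)) ripZl mulN1r. Qed.
Lemma ripNr x y : rip x (- y) = - rip x y.
Proof. by rewrite !(ripC x) ripNl. Qed.
Lemma ripBl x y z : rip (x - y) z = rip x z - rip y z.
Proof. by rewrite ripDl ripNl. Qed.
Lemma rip0l x : rip 0 x = 0.
Proof. by rewrite -(subrr x) ripBl subrr. Qed.
Lemma rip0r x : rip x 0 = 0.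
Proof. by rewrite ripC rip0l. Qed.

Lemma inner_xx x : inner x x = (nm x ^+ 2)%:C.
Proof. by rewrite inner_norm nmE -rmorphXn. Qed.

Lemma nm_sqrD x y : nm (x + y) ^+ 2 = nm x ^+ 2 + 2 * rip x y + nm y ^+ 2.
Proof. by rewrite -!rip_nm !ripDl !ripDr (ripC y x); ring. Qed.

Lemma nm_sqrB x y : nm (x - y) ^+ 2 = nm x ^+ 2 - 2 * rip x y + nm y ^+ 2.
Proof. by rewrite nm_sqrD nmN ripNr; ring. Qed.

Lemma innerBl x y z : inner (x - y) z = inner x z - inner y z.
Proof. by rewrite innerDl -scaleN1r innerZl mulN1r. Qed.
Lemma innerBr x y z : inner z (x - y) = inner z x - inner z y.
Proof. by rewrite innerDr -scaleN1r innerZr rmorphN1 mulN1r. Qed.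
Lemma inner0l x : inner 0 x = 0.
Proof. by rewrite -(subrr x) innerBl subrr. Qed.
Lemma inner0r x : inner x 0 = 0.
Proof. by rewrite -(subrr x) innerBr subrr. Qed.

End InnerProduct.

(** The discriminant of a nonnegative quadratic polynomial is nonpositive; a
    degenerate leading coefficient is allowed. *)
Lemma quad_discr (R : realType) (a b c : R) :
  0 <= c -> (forall t : R, 0 <= a + 2 * t * b + t ^+ 2 * c) -> b ^+ 2 <= a * c.
Proof.
move=> c0 h; have a0 : 0 <= a by have := h 0; rewrite mulr0 mul0r expr0n mul0r !addr0.
have [c00|cn0] := eqVneq c 0.
  rewrite c00 mulr0; suff -> : b = 0 by rewrite expr0n.
  apply/eqP; apply: contraT => bn0.
  have := h (- (a + 1) / (2 * b)); rewrite c00 mulr0 addr0.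
  have -> : a + 2 * (- (a + 1) / (2 * b)) * b = -1 by field.
  lra.
have cp : 0 < c by rewrite lt_def cn0.
have := h (- b / c).
have -> : a + 2 * (- b / c) * b + (- b / c) ^+ 2 * c = (a * c - b ^+ 2) / c by field.
by rewrite pmulr_lge0 ?invr_gt0 // subr_ge0.
Qed.

Section CauchySchwarz.
Variables (R : realType) (H : hilbertType R).
Implicit Types (x y z : H).

Lemma rip_sqr_le x y : rip x y ^+ 2 <= nm x ^+ 2 * nm y ^+ 2.
Proof.
apply: quad_discr; first exact: sqr_ge0.
move=> t; rewrite [X in 0 <= X](_ : _ = nm (x + t%:C *: y) ^+ 2) ?sqr_ge0 //.
by rewrite nm_sqrD ripZr nmZ nmC exprMn real_normK ?num_real //; ring.
Qed.

Lemma rip_le x y : `|rip x y| <= nm x * nm y.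
Proof.
rewrite -(@ler_pXn2r _ 2) ?nnegrE ?mulr_ge0 ?nm_ge0 // real_normK ?num_real //.
by rewrite exprMn rip_sqr_le.
Qed.

Lemma inner_le x y : nm (inner x y) <= nm x * nm y.
Proof.
have [->|n0] := eqVneq (nm (inner x y)) 0; first by rewrite mulr_ge0 ?nm_ge0.
have np : 0 < nm (inner x y) by rewrite lt_def n0 nm_ge0.
pose z := inner x y.
have : nm z ^+ 2 <= nm z * (nm x * nm y).
  have -> : nm z ^+ 2 = rip x (z *: y).
    by rewrite /rip innerZr -/z nm_sqr reM reJ imJ; ring.
  apply: le_trans (ler_norm _) _; apply: le_trans (rip_le _ _) _.
  by rewrite nmZ mulrCA.
by rewrite expr2 ler_pM2l.
Qed.

End CauchySchwarz.

(** * The Riesz representation theorem *)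
(** The rate 1/(n+1) of the minimizing and approximating sequences. *)
Definition inv_succ (R : realType) (n : nat) : R := n.+1%:R^-1.

Lemma inv_succ_gt0 (R : realType) n : 0 < inv_succ R n.
Proof. by rewrite invr_gt0. Qed.

Section Riesz.
Variables (R : realType) (H : hilbertType R).
Implicit Types (x y z : H) (A B : H -> H).

(** The way in which identities between limits are reduced to estimates. *)
Lemma le0_eps (a c : R) : 0 <= c -> (forall e, 0 < e -> a <= e * c) -> a <= 0.
Proof.
move=> c0 h; apply/ler_addgt0Pr => e e0; rewrite add0r.
have c1 : 0 < c + 1 by lra.
apply: le_trans (h (e / (c + 1)) (divr_gt0 e0 c1)) _.
by rewrite mulrAC ler_pdivrMr // ler_pM2l //; lra.
Qed.

Lemma inv_nat_lt (e : R) : 0 < e -> exists N, forall n, (N <= n)%N -> inv_succ R n < e.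
Proof.
move=> e0; have [N _ hN] := near_infty_natSinv_lt (PosNum e0).
by exists N => n Nn; exact: (hN n Nn).
Qed.

(** The representing vector minimizes J x = |x|^2 - 2 Re (f x).  By the
    parallelogram law a minimizing sequence is Cauchy, and near-minimality along
    the lines u_n + t y makes Re <u_n, y> close to Re (f y). *)
Lemma riesz (f : H -> R[i]) (M : R) :
  (forall a x y, f (a *: x + y) = a * f x + f y) ->
  (forall x, nm (f x) <= M * nm x) ->
  exists v, forall x, f x = inner x v.
Proof.
move=> flin fM.
have f0 : f 0 = 0.
  by have := flin (-1) 0 0; rewrite scaler0 addr0 mulN1r addNr.
have fD x y : f (x + y) = f x + f y by have := flin 1 x y; rewrite scale1r mul1r.
have fZ a x : f (a *: x) = a * f x by have := flin a x 0; rewrite !addr0 f0 addr0.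
have M0 : 0 <= `|M| by [].
pose g x := re (f x).
have gD x y : g (x + y) = g x + g y by rewrite /g fD reD.
have gZ (r : R) x : g (r%:C *: x) = r * g x by rewrite /g fZ reM /= mul0r subr0.
have gM x : `|g x| <= `|M| * nm x.
  apply: le_trans (re_le _) _; apply: le_trans (fM x) _.
  by rewrite ler_wpM2r ?nm_ge0 // ler_norm.
pose J x := nm x ^+ 2 - 2 * g x.
have Jlb x : - (`|M| ^+ 2) <= J x.
  have := gM x; rewrite ler_norml => /andP[_ h].
  have := sqr_ge0 (nm x - `|M|); rewrite /J; nra.
pose S : set R := range J.
have Sinf : has_inf S.
  split; first by exists (J 0), 0.
  by exists (- (`|M| ^+ 2)) => _ [x _ <-].
pose d := inf S.
have dJ x : d <= J x by apply: ge_inf; [case: Sinf | exists x].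
have approx (n : nat) : exists x, J x < d + inv_succ R n.
  have [_ [x _ <-] h] := @inf_adherent _ S (inv_succ R n) (inv_succ_gt0 R n) Sinf.
  by exists x.
have [u hu] := choice approx.
(* the parallelogram law at the midpoint of x and y *)
have par x y : nm (x - y) ^+ 2 <= 2 * (J x - d) + 2 * (J y - d).
  have := dJ (2^-1%:C *: (x + y)).
  rewrite /J gZ gD nmZ nmC exprMn real_normK ?num_real // (nm_sqrD x y) (nm_sqrB x y).
  lra.
have [|v hv] := cauchy_seq_nm (f := u).
  move=> e e0; have [N hN] := @inv_nat_lt (e ^+ 2 / 4) ltac:(by rewrite divr_gt0 ?exprn_gt0).
  exists N => m n /hN hm /hN hn.
  rewrite -(@ltr_pXn2r _ 2) ?nnegrE ?nm_ge0 ?(ltW e0) //.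
  have := par (u m) (u n); have := hu m; have := hu n.
  lra.
have stat n y : (rip (u n) y - g y) ^+ 2 <= inv_succ R n * nm y ^+ 2.
  apply: quad_discr; first exact: sqr_ge0.
  move=> t; have := dJ (u n + t%:C *: y); have := hu n.
  rewrite /J gD gZ nm_sqrD nmZ nmC ripZr exprMn real_normK ?num_real //; lra.
have gv y : rip v y = g y.
  apply/eqP; rewrite -subr_eq0 -normr_le0.
  apply: (@le0_eps _ (2 * nm y)) => [|e e0]; first by rewrite mulr_ge0 ?nm_ge0.
  have [N1 h1] := hv _ e0.
  have [N2 h2] := @inv_nat_lt (e ^+ 2) ltac:(by rewrite exprn_gt0).
  pose n := maxn N1 N2.
  have {}h1 := h1 n (leq_maxl _ _); have {}h2 := h2 n (leq_maxr _ _).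
  have s1 : `|rip (u n) y - g y| <= e * nm y.
    rewrite -(@ler_pXn2r _ 2) ?nnegrE ?mulr_ge0 ?nm_ge0 ?(ltW e0) // real_normK ?num_real //.
    rewrite exprMn; apply: le_trans (stat n y) _.
    by rewrite ler_wpM2r ?sqr_ge0 // ltW.
  have s2 : `|rip (u n - v) y| <= e * nm y.
    apply: le_trans (rip_le _ _) _.
    by rewrite ler_wpM2r ?nm_ge0 // ltW.
  have -> : rip v y - g y = (rip (u n) y - g y) - rip (u n - v) y by rewrite ripBl; ring.
  apply: le_trans (ler_normB _ _) _; lra.
exists v => x; apply: complex_eq; first by rewrite -/(rip x v) ripC gv.
have -> : im (inner x v) = - re (inner ('i%C *: x) v) by rewrite innerZl reM /=; ring.
by rewrite -/(rip _ v) ripC gv /g fZ reM /=; ring.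
Qed.

Lemma linD A : linear A -> forall x y, A (x + y) = A x + A y.
Proof. by move=> lA x y; have := lA 1 x y; rewrite !scale1r. Qed.
Lemma lin0 A : linear A -> A 0 = 0.
Proof. by move=> lA; have := lA (-1) 0 0; rewrite scaler0 addr0 scaleN1r addNr. Qed.
Lemma linZ A : linear A -> forall a x, A (a *: x) = a *: A x.
Proof. by move=> lA a x; have := lA a x 0; rewrite (lin0 lA) !addr0. Qed.
Lemma linB A : linear A -> forall x y, A (x - y) = A x - A y.
Proof. by move=> lA x y; rewrite (linD lA) -scaleN1r (linZ lA) scaleN1r. Qed.

Definition op_le A (M : R) := forall x, nm (A x) <= M * nm x.

Lemma op_leW A (M N : R) : M <= N -> op_le A M -> op_le A N.
Proof. by move=> MN h x; apply: le_trans (h x) _; rewrite ler_wpM2r ?nm_ge0. Qed.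

Lemma bounded_operatorP A : bounded_operator A <-> linear A /\ exists M : R, op_le A M.
Proof.
split=> -[lA [M hM]]; split=> //.
  exists (re M) => x; have := hM x.
  by rewrite !nmE lecE reM /= mulr0 subr0 => /andP[].
exists M%:C => x; rewrite !nmE -rmorphM lecR.
exact: hM.
Qed.

End Riesz.

(** * Adjoints, operator algebras and positive operators *)
Section Adjoint.
Variables (R : realType) (H : hilbertType R).
Implicit Types (x y z : H) (A B T : H -> H).

Lemma inner_inj y z : (forall x, inner x y = inner x z) -> y = z.
Proof.
move=> h; apply/eqP; rewrite -subr_eq0; apply/eqP/nm_eq0.
apply/eqP; rewrite -sqrf_eq0; apply/eqP.
by rewrite -rip_nm /rip innerBr h subrr.
Qed.

(** Identities between vectors become ring identities under every functional
    inner _ z. *)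
Lemma vec_eq x y : (forall z, inner x z = inner y z) -> x = y.
Proof. by move=> h; apply: inner_inj => z; rewrite innerC h -innerC. Qed.

Lemma innerNl x y : inner (- x) y = - inner x y.
Proof. by rewrite -sub0r innerBl inner0l sub0r. Qed.

Lemma adjoint_inner A : bounded_operator A ->
  forall x y, inner (A x) y = inner x (adjoint A y).
Proof.
move=> /bounded_operatorP[lA [M hM]].
have /choice[B hB] : forall y, exists v, forall x, inner (A x) y = inner x v.
  move=> y; apply: (@riesz _ _ _ (M * nm y)).
    by move=> a u v; rewrite lA innerDl innerZl.
  move=> x; apply: le_trans (inner_le _ _) _.
  by rewrite mulrAC ler_wpM2r ?nm_ge0.
by apply: (@getPex _ [set B : H -> H | forall x y, inner (A x) y = inner x (B y)]); exists B.
Qed.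

Lemma adjoint_unique A B :
  (forall x y, inner (A x) y = inner x (B y)) -> adjoint A = B.
Proof.
move=> h; have hA : forall x y, inner (A x) y = inner x (adjoint A y).
  by apply: (@getPex _ [set B : H -> H | forall x y, inner (A x) y = inner x (B y)]); exists B.
by apply/funext => y; apply: inner_inj => x; rewrite -hA h.
Qed.

Lemma adjoint_inner' A : bounded_operator A ->
  forall x y, inner (adjoint A x) y = inner x (A y).
Proof. by move=> bA x y; rewrite innerC -adjoint_inner // -innerC. Qed.

Lemma adjoint_linear A : bounded_operator A -> linear (adjoint A).
Proof.
move=> bA a x y; apply: inner_inj => z.
by rewrite -adjoint_inner // !innerDr !innerZr -!adjoint_inner.
Qed.

(** |A^* y|^2 = <A (A^* y), y> <= M |A^* y| |y|. *)
Lemma adjoint_op_le A M : bounded_operator A -> op_le A M -> op_le (adjoint A) M.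
Proof.
move=> bA hM y; have [->|n0] := eqVneq (nm (adjoint A y)) 0.
  have [->|y0] := eqVneq y 0; first by rewrite nm0 mulr0.
  rewrite mulr_ge0 ?nm_ge0 // -(pmulr_lge0 _ (_ : 0 < nm y)); last first.
    by rewrite lt_def nm_ge0 andbT; apply: contra_neq y0 => /nm_eq0.
  by apply: le_trans (hM y); exact: nm_ge0.
have np : 0 < nm (adjoint A y) by rewrite lt_def n0 nm_ge0.
rewrite -(ler_pM2l np) -expr2 -rip_nm /rip -adjoint_inner //.
apply: le_trans (ler_norm _) _; apply: le_trans (rip_le _ _) _.
by rewrite mulrA ler_wpM2r ?nm_ge0 // mulrC.
Qed.

Lemma adjoint_bounded A : bounded_operator A -> bounded_operator (adjoint A).
Proof.
move=> bA; apply/bounded_operatorP; split; first exact: adjoint_linear.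
by have /bounded_operatorP[_ [M hM]] := bA; exists M; exact: adjoint_op_le.
Qed.

Lemma bounded_op_le A : bounded_operator A -> exists2 M : R, 1 <= M & op_le A M.
Proof.
move=> /bounded_operatorP[_ [M hM]]; exists (Num.max 1 M); first by rewrite le_max lexx.
by apply: op_leW hM; rewrite le_max lexx orbT.
Qed.

Lemma inner_op_le A M x : op_le A M -> nm x = 1 -> nm (inner (A x) x) <= M.
Proof.
move=> hM x1; apply: le_trans (inner_le _ _) _; rewrite x1 mulr1.
by apply: le_trans (hM x) _; rewrite x1 mulr1.
Qed.

Lemma bounded_lin A : bounded_operator A -> linear A.
Proof. by case. Qed.

Lemma bounded_comb (a : R[i]) A B : bounded_operator A -> bounded_operator B ->
  bounded_operator (fun x => a *: A x + B x).
Proof.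
move=> bA bB; have [M _ hM] := bounded_op_le bA; have [N _ hN] := bounded_op_le bB.
apply/bounded_operatorP; split.
  move=> c x y; rewrite (bounded_lin bA) (bounded_lin bB) !scalerDr !scalerA (mulrC a).
  by rewrite addrACA.
exists (nm a * M + N) => x; apply: le_trans (nmD _ _) _.
by rewrite mulrDl lerD // nmZ -mulrA ler_wpM2l ?nm_ge0.
Qed.

Lemma bounded_id : bounded_operator (@id H).
Proof. by apply/bounded_operatorP; split=> //; exists 1 => x; rewrite mul1r. Qed.

Lemma bounded_comp A B : bounded_operator A -> bounded_operator B ->
  bounded_operator (A \o B).
Proof.
move=> bA bB; have [M M1 hM] := bounded_op_le bA; have [N _ hN] := bounded_op_le bB.
apply/bounded_operatorP; split.
  by move=> c x y; rewrite /= (bounded_lin bB) (bounded_lin bA).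
exists (M * N) => x; apply: le_trans (hM _) _.
by rewrite -mulrA ler_wpM2l ?hN //; lra.
Qed.

Lemma bounded_cstar : unital_cstar_subalgebra (@bounded_operator R H).
Proof.
split => //.
- exact: bounded_id.
- exact: bounded_comb.
- exact: bounded_comp.
- exact: adjoint_bounded.
Qed.

Lemma generated_cstar T : bounded_operator T ->
  unital_cstar_subalgebra (generated_cstar_algebra T).
Proof.
move=> bT; split.
- move=> A hA; apply: hA; split; first exact: bounded_cstar.
  by move=> _ ->.
- by move=> S [cS _]; exact: cstar_id.
- by move=> a A B hA hB S cS; apply: cstar_linear; [case: cS | exact: hA | exact: hB].
- by move=> A B hA hB S cS; apply: cstar_comp; [case: cS | exact: hA | exact: hB].
- by move=> A hA S cS; apply: cstar_adjoint; [case: cS | exact: hA].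
- move=> A bA h S cS; apply: (cstar_closed (proj1 cS)) => // e e0.
  by have [B hB le] := h e e0; exists B => //; exact: hB.
Qed.

Lemma generated_self T : generated_cstar_algebra T T.
Proof. by move=> S [_]; apply. Qed.

End Adjoint.

Ltac vec_ring := apply: vec_eq => ?; rewrite !(innerDl, innerNl, innerZl); ring.

Section RealSymmetric.
Variables (R : realType) (H : hilbertType R).
Implicit Types (x y z : H) (A B T : H -> H).

(** Symmetry for the underlying real Hilbert space: the perturbation argument for
    the curvature uses only real scalars. *)
Definition real_symmetric A :=
  (forall (t : R) x y, A (t%:C *: x + y) = t%:C *: A x + A y) /\
  (forall x y, rip (A x) y = rip x (A y)).

Lemma rsymD A : real_symmetric A -> forall (t : R) x y, A (x + t%:C *: y) = A x + t%:C *: A y.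
Proof. by case=> lA _ t x y; rewrite addrC lA addrC. Qed.

Lemma rsym_quad A : real_symmetric A -> forall (t : R) x y,
  rip (A (x + t%:C *: y)) (x + t%:C *: y) =
  rip (A x) x + 2 * t * rip (A x) y + t ^+ 2 * rip (A y) y.
Proof.
move=> sA t x y; rewrite (rsymD sA) !ripDl !ripDr !ripZl !ripZr.
have -> : rip (A y) x = rip (A x) y by rewrite (proj2 sA) ripC.
ring.
Qed.

(** The Cauchy-Schwarz inequality for the semi-inner product <B x, y>, at
    y = B x. *)
Lemma psd_sqr B (M : R) : real_symmetric B -> (forall x, 0 <= rip (B x) x) ->
  0 <= M -> op_le B M -> forall x, nm (B x) ^+ 2 <= M * rip (B x) x.
Proof.
move=> sB pB M0 hM x.
have [->|n0] := eqVneq (nm (B x)) 0; first by rewrite expr0n mulr_ge0.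
have np : 0 < nm (B x) ^+ 2 by rewrite exprn_gt0 // lt_def n0 nm_ge0.
have cs : (nm (B x) ^+ 2) ^+ 2 <= rip (B x) x * rip (B (B x)) (B x).
  rewrite -rip_nm; apply: quad_discr => // t.
  by rewrite -rsym_quad.
have up : rip (B (B x)) (B x) <= M * nm (B x) ^+ 2.
  apply: le_trans (ler_norm _) _; apply: le_trans (rip_le _ _) _.
  by rewrite expr2 mulrA ler_wpM2r ?nm_ge0.
rewrite -(ler_pM2l np) -expr2; apply: le_trans cs _.
apply: le_trans (ler_wpM2l (pB x) up) _.
by rewrite mulrA (mulrC (rip _ _ * M)) (mulrC (rip _ _)).
Qed.

End RealSymmetric.

(** * Square roots in a C*-algebra of operators *)
Section SquareRoot.
Variables (R : realType) (H : hilbertType R) (S : set (H -> H)).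
Hypothesis cS : unital_cstar_subalgebra S.
Implicit Types (x y z : H) (A B T : H -> H).

Definition selfadj A := forall x y, inner (A x) y = inner x (A y).

Lemma cstar_lin A : S A -> linear A.
Proof. by move=> /(cstar_bounded cS)[]. Qed.

Lemma cstar_zero : S (fun=> 0).
Proof.
have := cstar_linear cS (-1) (cstar_id cS) (cstar_id cS).
by congr S; apply/funext => x; rewrite scaleN1r addNr.
Qed.

Lemma cstar_scale a A : S A -> S (fun x => a *: A x).
Proof.
move=> sA; have := cstar_linear cS a sA cstar_zero.
by congr S; apply/funext => x; rewrite addr0.
Qed.

Lemma selfadj_rsym A : linear A -> selfadj A -> real_symmetric A.
Proof.
by move=> lA sA; split; [move=> t x y; exact: lA | move=> x y; rewrite /rip sA].
Qed.

Lemma expr_lt (r e : R) : 0 <= r < 1 -> 0 < e -> exists N, forall n, (N <= n)%N -> r ^+ n < e.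
Proof.
move=> /andP[r0 r1] e0.
have /cvgrPdist_lt/(_ _ e0)[N _ hN] := @cvg_expr R r ltac:(by rewrite ger0_norm).
exists N => n Nn; have := hN n Nn.
by rewrite /= sub0r normrN ger0_norm // exprn_ge0.
Qed.

Section FixedPoint.
Variables (A : H -> H) (r : R).
Hypotheses (SA : S A) (sA : selfadj A) (r01 : 0 <= r < 1).
Hypothesis hA : op_le A (2 * r - r ^+ 2).

Let half : R := 2^-1.

(** Iterates of Y |-> (A + Y^2) / 2, whose fixed point Y satisfies
    (1 - Y)^2 = 1 - A. *)
Fixpoint sqrt_iter n : H -> H :=
  if n is m.+1 then fun x => half%:C *: (A x + sqrt_iter m (sqrt_iter m x))
  else fun=> 0.
Local Notation Y := sqrt_iter.

Let r0 : 0 <= r. Proof. by case/andP: r01. Qed.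
Let r1 : r < 1. Proof. by case/andP: r01. Qed.

Let SY n : S (Y n).
Proof.
elim: n => [|n IH]; first exact: cstar_zero.
have := cstar_scale half%:C (cstar_linear cS 1 SA (cstar_comp cS IH IH)).
by congr S; apply/funext => x /=; rewrite scale1r.
Qed.

Let sY n : selfadj (Y n).
Proof.
elim: n => [|n IH] x y; first by rewrite inner0l inner0r.
rewrite /= innerZl innerZr innerDl innerDr sA !IH; congr (_ * _).
by apply: complex_eq; rewrite ?reJ ?imJ /= ?oppr0.
Qed.

Let hY n : op_le (Y n) r.
Proof.
elim: n => [|n IH] x /=; first by rewrite nm0 mulr_ge0 ?nm_ge0.
rewrite nmZ nmC ger0_norm ?invr_ge0 //.
have h1 := nmD (A x) (Y n (Y n x)); have h2 := hA x; have h3 := IH x.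
have h4 : nm (Y n (Y n x)) <= r * (r * nm x).
  by apply: le_trans (IH _) _; rewrite ler_wpM2l.
rewrite /half; nra.
Qed.

Let dY n x : nm (Y n.+1 x - Y n x) <= r ^+ n.+1 * nm x.
Proof.
elim: n x => [|n IH] x.
  by rewrite expr1 [Y 0 x]/= subr0; exact: hY.
have -> : Y n.+2 x - Y n.+1 x = half%:C *: ((Y n.+1 (Y n.+1 x) - Y n (Y n.+1 x)) +
     (Y n (Y n.+1 x - Y n x))).
  rewrite (linB (cstar_lin (SY n))) addrA subrK.
  rewrite [Y n.+2 x]/= [X in _ - X]/= -scalerBr; congr (_ *: _).
  by rewrite opprD addrACA subrr add0r.
rewrite nmZ nmC ger0_norm ?invr_ge0 //.
have h1 := nmD (Y n.+1 (Y n.+1 x) - Y n (Y n.+1 x)) (Y n (Y n.+1 x - Y n x)).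
have h2 : nm (Y n.+1 (Y n.+1 x) - Y n (Y n.+1 x)) <= r ^+ n.+1 * (r * nm x).
  by apply: le_trans (IH _) _; rewrite ler_wpM2l ?exprn_ge0 ?hY.
have h3 : nm (Y n (Y n.+1 x - Y n x)) <= r * (r ^+ n.+1 * nm x).
  by apply: le_trans (hY _ _) _; rewrite ler_wpM2l.
rewrite exprSr /half; lra.
Qed.

Let cY n k x : (1 - r) * nm (Y (n + k) x - Y n x) <= (r ^+ n.+1 - r ^+ (n + k).+1) * nm x.
Proof.
elim: k => [|k IH]; first by rewrite addn0 !subrr nm0 mulr0 mul0r.
have h1 := dY (n + k) x.
have h2 : nm (Y (n + k.+1) x - Y n x) <= nm (Y (n + k).+1 x - Y (n + k) x) + nm (Y (n + k) x - Y n x).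
  by apply: le_trans (nmD _ _); rewrite addrA subrK addnS.
have h3 := nm_ge0 x.
have h4 : (1 - r) * nm (Y (n + k.+1) x - Y n x) <=
   (1 - r) * (nm (Y (n + k).+1 x - Y (n + k) x) + nm (Y (n + k) x - Y n x)).
  by rewrite ler_wpM2l // subr_ge0 ltW.
have h5 : (1 - r) * nm (Y (n + k).+1 x - Y (n + k) x) <= (1 - r) * (r ^+ (n + k).+1 * nm x).
  by rewrite ler_wpM2l // subr_ge0 ltW.
rewrite [r ^+ (n + k.+1).+1]exprS addnS in h4 *; lra.
Qed.

Let uY (e : R) : 0 < e -> exists N, forall n k x, (N <= n)%N ->
  nm (Y (n + k) x - Y n x) <= e * nm x.
Proof.
move=> e0; have e1 : 0 < e * (1 - r) by rewrite mulr_gt0 // subr_gt0.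
have [N hN] := expr_lt r01 e1; exists N => n k x Nn.
have p : 0 < 1 - r by rewrite subr_gt0.
rewrite -(ler_pM2l p); apply: le_trans (cY n k x) _.
rewrite mulrA ler_wpM2r ?nm_ge0 // [X in _ <= X]mulrC.
have := hN n.+1 (leq_trans Nn (leqnSn _)); have := exprn_ge0 (n + k).+1 r0; lra.
Qed.

(** On the operators of norm at most r, the map Y |-> (A + Y^2) / 2 is a
    contraction with factor r, also for operators that do not commute; the bound
    2 r - r^2 on A is the one that makes this ball invariant.  Its iterates
    converge in the operator norm, hence inside S. *)
Lemma cstar_sqrt : exists Q, [/\ S Q, selfadj Q & forall x, Q (Q x) = x - A x].
Proof.
have /choice[L hL] : forall x, exists l, forall e : R, 0 < e ->
    exists N, forall n, (N <= n)%N -> nm (Y n x - l) < e.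
  move=> x; apply: cauchy_seq_nm => e e0.
  have e1 : 0 < e / (nm x + 1) / 3.
    by rewrite !divr_gt0 // ltr_wpDl ?nm_ge0.
  have [N hN] := uY e1; exists N.
  have h k : nm (Y (N + k) x - Y N x) <= e / 3.
    apply: le_trans (hN N k x (leqnn _)) _.
    rewrite mulrAC ler_pM2r // -mulrA ger_pMr // mulrC ler_pdivrMr; last by have := nm_ge0 x; lra.
    by rewrite mul1r lerDl.
  move=> m n Nm Nn; rewrite -(subnKC Nm) -(subnKC Nn).
  have h1 := h (m - N)%N; have h2 := h (n - N)%N.
  have := nmD (Y (N + (m - N)) x - Y N x) (Y N x - Y (N + (n - N)) x).
  rewrite (nmBC (Y N x)) addrA subrK; lra.
have uL (e : R) : 0 < e -> exists N, forall n x, (N <= n)%N ->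
    nm (L x - Y n x) <= e * nm x.
  move=> e0; have [N hN] := uY e0; exists N => n x Nn.
  apply/ler_addgt0Pr => d d0; have [N' hN'] := hL x d d0.
  have := hN n N' x Nn; have := hN' (n + N')%N (leq_addl _ _).
  have := nmD (L x - Y (n + N')%N x) (Y (n + N')%N x - Y n x).
  rewrite addrA subrK (nmBC (L x) (Y (n + N')%N x)); lra.
have zero (c : R) z : 0 <= c -> (forall e, 0 < e -> nm z <= e * c) -> z = 0 :> H.
  move=> c0 h; apply: nm_eq0; apply/eqP.
  by rewrite eq_le nm_ge0 andbT; exact: (le0_eps c0 h).
have linL : linear L.
  move=> a x y; apply/eqP; rewrite -subr_eq0; apply/eqP.
  apply: (zero (nm (a *: x + y) + nm a * nm x + nm y)) => [|e e0].
    by rewrite !addr_ge0 ?mulr_ge0 ?nm_ge0.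
  have [N hN] := uL e e0.
  have -> : L (a *: x + y) - (a *: L x + L y) =
     (L (a *: x + y) - Y N (a *: x + y)) - (a *: (L x - Y N x) + (L y - Y N y)).
    by rewrite (cstar_lin (SY N)); vec_ring.
  have h1 := hN N (a *: x + y) (leqnn _); have h2 := hN N x (leqnn _); have h3 := hN N y (leqnn _).
  apply: le_trans (nmD _ _) _; rewrite nmN.
  have h4 := nmD (a *: (L x - Y N x)) (L y - Y N y).
  have h5 : nm (a *: (L x - Y N x)) <= nm a * (e * nm x).
    by rewrite nmZ ler_wpM2l ?nm_ge0.
  lra.
have bL : bounded_operator L.
  apply/bounded_operatorP; split => //.
  have [N hN] := uL 1 ltr01; exists (1 + r) => x.
  have := hN N x (leqnn _); have := hY N x; have := nmD (L x - Y N x) (Y N x).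
  rewrite subrK; lra.
have SL : S L.
  apply: (cstar_closed cS) => // e; rewrite ltcE /= => /andP[/eqP ie e0].
  have [N hN] := uL _ e0; exists (Y N) => // x.
  by rewrite !nmE lecE reM imM /= ie !mulr0 mul0r addr0 eqxx subr0 hN.
have sL : selfadj L.
  move=> x y; apply/eqP; rewrite -subr_eq0; apply/eqP.
  have z0 (z : R[i]) : nm z <= 0 -> z = 0.
    by move=> h; apply: (@nm_eq0 R _ (z : R[i]^o)); apply/eqP; rewrite eq_le h nm_ge0.
  apply: z0; apply: (@le0_eps _ _ (2 * nm x * nm y)) => [|e e0].
    by rewrite !mulr_ge0 ?nm_ge0.
  have [N hN] := uL e e0.
  have -> : inner (L x) y - inner x (L y) = inner (L x - Y N x) y - inner x (L y - Y N y).
    by rewrite innerBl innerBr sY; ring.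
  apply: le_trans (nmD _ _) _; rewrite nmN.
  have h1 := inner_le (L x - Y N x) y; have h2 := inner_le x (L y - Y N y).
  have h3 : nm (L x - Y N x) * nm y <= e * nm x * nm y by rewrite ler_wpM2r ?nm_ge0 ?hN.
  have h4 : nm x * nm (L y - Y N y) <= nm x * (e * nm y) by rewrite ler_wpM2l ?nm_ge0 ?hN.
  lra.
have fixL x : L (L x) = L x + L x - A x.
  apply/eqP; rewrite -subr_eq0; apply/eqP.
  apply: (zero (nm (L x) + r * nm x + 2 * nm x)) => [|e e0].
    by rewrite !addr_ge0 ?mulr_ge0 ?nm_ge0.
  have [N hN] := uL e e0.
  have eqY : Y N (Y N x) = Y N.+1 x + Y N.+1 x - A x.
    rewrite /= -scalerDl -rmorphD.
    have -> : half + half = 1 by rewrite /half; lra.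
    by rewrite scale1r addrC addKr.
  have -> : L (L x) - (L x + L x - A x) =
     (L (L x) - Y N (L x)) + Y N (L x - Y N x) - ((L x - Y N.+1 x) + (L x - Y N.+1 x)).
    rewrite (linB (cstar_lin (SY N))) eqY.
    move: (L (L x)) (L x) (Y N.+1 x) (A x) (Y N (L x)) => a b c d f.
    by vec_ring.
  apply: le_trans (nmD _ _) _; rewrite nmN.
  have h1 := nmD (L (L x) - Y N (L x)) (Y N (L x - Y N x)).
  have h2 := nmD (L x - Y N.+1 x) (L x - Y N.+1 x).
  have h3 := hN N (L x) (leqnn _); have h4 := hN N.+1 x (leqnSn _).
  have h5 := hY N (L x - Y N x).
  have h6 : r * nm (L x - Y N x) <= r * (e * nm x) by rewrite ler_wpM2l ?hN.
  lra.
exists (fun x => x - L x); split.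
- have := cstar_linear cS (-1) SL (cstar_id cS).
  by congr S; apply/funext => x; rewrite scaleN1r addrC.
- by move=> x y; rewrite innerBl innerBr sL.
- move=> x; rewrite (linB linL) fixL.
  move: (L x) (A x) => b d.
  by vec_ring.
Qed.

End FixedPoint.
End SquareRoot.

(** * Convexity of numerical ranges *)
Section ToeplitzHausdorff.
Variables (R : realType) (H : hilbertType R).
Implicit Types (x y z : H) (A B T : H -> H) (V : set H).

Lemma conjC_real (t : R) : (t%:C)^* = t%:C :> R[i].
Proof. by apply: complex_eq; rewrite ?reJ ?imJ /= ?oppr0. Qed.

Lemma conjM_real (t : R) (z : R[i]) : (t%:C * z)^* = t%:C * z^*.
Proof. by rewrite -[in RHS]conjC_real; exact: rmorphM. Qed.

Lemma mul_conj (z : R[i]) : z * z^* = (nm z ^+ 2)%:C.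
Proof. by rewrite rmorphXn /= -nmE normCK. Qed.

(** Every complex number is rotated onto the nonnegative half-axis. *)
Lemma phase (w : R[i]) : exists mu : R[i], nm mu = 1 /\ mu * w = (nm w)%:C.
Proof.
have nm1 : nm (1 : R[i]) = 1 by rewrite /nm normr1.
have [->|w0] := eqVneq w 0; first by exists 1; rewrite mulr0 nm0.
have n0 : nm w != 0 by apply: contra_neq w0 => /(@nm_eq0 R R[i]^o).
have n0' : (nm w)%:C != 0 :> R[i] by rewrite -(rmorph0 (real_complex R)) (inj_eq (@complexI R)).
exists (w^* / (nm w)%:C); split; last first.
  by rewrite mulrAC (mulrC _ w) mul_conj rmorphXn /= expr2 mulfK.
apply: (mulIf n0); rewrite mul1r -[X in _ * X](ger0_norm (nm_ge0 w)) -nmC -nmM mulfVK //.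
by rewrite nm_conj.
Qed.

Definition lin_subspace V := forall (a : R[i]) x y, V x -> V y -> V (a *: x + y).

Lemma subspaceZ V a x : lin_subspace V -> V x -> V (a *: x).
Proof. by move=> sV Vx; rewrite -(subrK 1 a) scalerDl scale1r; exact: sV. Qed.

Definition restricted_range T V : set R[i] :=
  [set inner (T x) x | x in [set x | V x /\ nm x = 1]].

Lemma normalize x : x <> 0 -> exists2 r : R, 0 < r & nm (r%:C *: x) = 1.
Proof.
move=> x0; have np : 0 < nm x.
  by rewrite lt_def nm_ge0 andbT; apply/eqP => /nm_eq0.
exists (nm x)^-1; first by rewrite invr_gt0.
by rewrite nmZ nmC ger0_norm ?invr_ge0 ?nm_ge0 // mulVf // gt_eqF.
Qed.

Lemma normalize_sqr x (r : R) : nm (r%:C *: x) = 1 -> r ^+ 2 * nm x ^+ 2 = 1.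
Proof. by rewrite nmZ nmC -(real_normK (num_real r)) -exprMn => ->; rewrite expr1n. Qed.

(** Replacing T by an affine image psi, the two values are 0 and 1.  A rotation
    of x makes the cross term of psi real along the segment v from x to y, so
    that the wanted value is found by the intermediate value theorem for a real
    quadratic polynomial. *)
Lemma toeplitz_hausdorff T V (t : R) a b : linear T -> lin_subspace V ->
  0 <= t <= 1 -> restricted_range T V a -> restricted_range T V b ->
  restricted_range T V (t%:C * a + (1 - t)%:C * b).
Proof.
move=> lT sV /andP[t0 t1] [x [Vx x1] <-] [y [Vy y1] <-].
set al := inner (T x) x; set be := inner (T y) y.
have [ab|nab] := eqVneq be al.
  by exists x => //; rewrite ab -mulrDl -rmorphD addrC subrK mul1r.
have dn : be - al != 0 by rewrite subr_eq0.
pose psi v w := (be - al)^-1 * (inner (T v) w - al * inner v w).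
have psixx : psi x x = 0 by rewrite /psi inner_xx x1 expr1n mulr1 subrr mulr0.
have psiyy : psi y y = 1 by rewrite /psi inner_xx y1 expr1n mulr1 mulVf.
(* with this mu the cross term mu psi(x,y) + conj(mu) psi(y,x) is real *)
have [mu [mu1 hmu]] := phase (psi x y - (psi y x)^*).
pose v (u : R) := ((1 - u)%:C * mu) *: x + u%:C *: y.
pose c := re (mu * psi x y + mu^* * psi y x).
have imc : im (mu * psi x y + mu^* * psi y x) = 0.
  have : im (mu * (psi x y - (psi y x)^*)) = 0 by rewrite hmu.
  move: (psi x y) (psi y x) => p q.
  by rewrite mulrBr !imD imN !imM !reJ !imJ; lra.
have cE : mu * psi x y + mu^* * psi y x = c%:C by apply: complex_eq.
have psiv u : psi (v u) (v u) = (u ^+ 2 + u * (1 - u) * c)%:C.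
  transitivity (((1 - u) ^+ 2)%:C * (mu * mu^*) * psi x x +
     (u * (1 - u))%:C * (mu * psi x y + mu^* * psi y x) + (u ^+ 2)%:C * psi y y).
    rewrite /psi /v !(linD lT) !(linZ lT) !(innerDl, innerDr, innerZl, innerZr).
    rewrite conjM_real conjC_real ?rmorphXn ![(_ * _)%:C]rmorphM /=; ring.
  by rewrite psixx psiyy cE mulr0 add0r mulr1 -rmorphM -rmorphD addrC.
pose d := rip (mu *: x) y.
have nmv u : nm (v u) ^+ 2 = (1 - u) ^+ 2 + u ^+ 2 + 2 * (u * (1 - u)) * d.
  rewrite /v -scalerA nm_sqrD !nmZ !nmC mu1 x1 y1 ripZl ripZr -/d.
  by rewrite !mulr1 !real_normK ?num_real //; ring.
pose s := 1 - t.
pose P : {poly R} := 'X^2 + c%:P * ('X * (1 - 'X)) -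
   s%:P * ((1 - 'X) ^+ 2 + 'X^2 + (2 * d)%:P * ('X * (1 - 'X))).
have PE u : P.[u] = u ^+ 2 + c * (u * (1 - u)) -
   s * ((1 - u) ^+ 2 + u ^+ 2 + 2 * d * (u * (1 - u))).
  by rewrite /P !hornerE.
have [|u /andP[u0 u1] /rootP] := @poly_ivt R P 0 1 ler01.
  by rewrite !PE /s; apply/andP; split; lra.
rewrite PE => hu.
have hv : psi (v u) (v u) = (s * nm (v u) ^+ 2)%:C.
  by rewrite psiv nmv; congr (_%:C); lra.
have vn0 : v u <> 0.
  move=> v0.
  have yE : u%:C *: y = (- (1 - u)%:C * mu) *: x.
    by apply/eqP; rewrite mulNr scaleNr -addr_eq0 addrC -/(v u) v0.
  have psiZ (k : R[i]) z : psi (k *: z) (k *: z) = k * k^* * psi z z.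
    by rewrite /psi (linZ lT) !(innerZl, innerZr); ring.
  have := psiZ u%:C y; rewrite yE psiZ psixx psiyy mulr0 mulr1 conjC_real => /esym/eqP.
  rewrite mulf_eq0 orbb => /eqP/complexI uz.
  move: v0; rewrite /v uz scale0r addr0 subr0 mul1r => /(congr1 (@nm _ _)).
  by rewrite nmZ mu1 x1 nm0 mulr1 => /eqP; rewrite oner_eq0.
have [r r0 hr] := normalize vn0.
exists (r%:C *: v u).
  split => //; apply: subspaceZ => //.
  by apply: (sV) => //; exact: subspaceZ.
have nv := normalize_sqr hr.
have Tv : inner (T (v u)) (v u) = (nm (v u) ^+ 2)%:C * (al + s%:C * (be - al)).
  have h : inner (T (v u)) (v u) - al * (nm (v u) ^+ 2)%:C =
     (be - al) * (s * nm (v u) ^+ 2)%:C by rewrite -hv /psi inner_xx mulVKf.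
  rewrite -[LHS](subrK (al * (nm (v u) ^+ 2)%:C)) h [(s * _)%:C]rmorphM /=; ring.
rewrite (linZ lT) innerZl innerZr conjC_real Tv !mulrA -!rmorphM -expr2 nv mul1r.
by rewrite /s !rmorphB rmorph1; ring.
Qed.

End ToeplitzHausdorff.

(** * States and the closure of the numerical range *)
Section States.
Variables (R : realType) (H : hilbertType R) (S : set (H -> H)).
Variable (phi : (H -> H) -> R[i]).
Hypotheses (cS : unital_cstar_subalgebra S) (sphi : state S phi).
Implicit Types (x y z : H) (A B T : H -> H).

Lemma state_zero : phi (fun=> 0) = 0.
Proof.
have := state_linear sphi (-1) (cstar_id cS) (cstar_id cS).
rewrite mulN1r addNr => <-; congr phi.
by apply/funext => x; rewrite scaleN1r addNr.
Qed.

Lemma state_scale a A : S A -> phi (fun x => a *: A x) = a * phi A.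
Proof.
move=> SA; rewrite -[RHS]addr0 -state_zero -(state_linear sphi) //; last exact: (cstar_zero cS).
by congr phi; apply/funext => x; rewrite addr0.
Qed.

(** If 0 <= B <= M, then A = 1 - B / M has norm at most 1, so that 1 - k A is a
    square Q^2 for every k = 2 r - r^2 < 1, and phi (Q^* Q) >= 0.  Let r tend to
    1. *)
Lemma state_positive_sa B : S B -> selfadj B -> (forall x, 0 <= rip (B x) x) -> 0 <= phi B.
Proof.
move=> SB sB pB; have bB := cstar_bounded cS SB.
have [M M1 hM] := bounded_op_le bB; have lB := cstar_lin cS SB.
have M0 : 0 < M by lra.
pose A x := x - M^-1%:C *: B x.
have hA x : nm (A x) <= nm x.
  rewrite -(@ler_pXn2r _ 2) ?nnegrE ?nm_ge0 // nm_sqrB nmZ nmC ripZr exprMn.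
  rewrite real_normK ?num_real //.
  have h := psd_sqr (selfadj_rsym lB sB) pB (ltW M0) hM x.
  have : M^-1 ^+ 2 * nm (B x) ^+ 2 <= M^-1 ^+ 2 * (M * rip (B x) x).
    by rewrite ler_wpM2l // exprn_ge0 // invr_ge0 ltW.
  have -> : M^-1 ^+ 2 * (M * rip (B x) x) = M^-1 * rip (B x) x by field; rewrite gt_eqF.
  rewrite (ripC x); have : 0 <= M^-1 * rip (B x) x by rewrite mulr_ge0 ?pB // invr_ge0 ltW.
  lra.
have key r : 0 <= r < 1 -> 0 <= ((1 - r) ^+ 2)%:C + ((2 * r - r ^+ 2) / M)%:C * phi B.
  move=> r01; have /andP[r0 r1] := r01.
  pose k := 2 * r - r ^+ 2.
  have k0 : 0 <= k by rewrite /k; nra.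
  pose Ar x := k%:C *: A x.
  have SA : S A.
    have := cstar_linear cS (- M^-1%:C) SB (cstar_id cS).
    by congr S; apply/funext => x; rewrite scaleNr addrC.
  have SAr : S Ar by exact: (cstar_scale cS).
  have sAr : selfadj Ar.
    move=> x y; rewrite /Ar /A !(innerZl, innerZr, innerBl, innerBr) sB.
    by rewrite !conjC_real.
  have hAr : op_le Ar k.
    by move=> x; rewrite /Ar nmZ nmC ger0_norm // ler_wpM2l.
  have [Q [SQ sQ QQ]] := cstar_sqrt cS SAr sAr r01 hAr.
  have := state_positive sphi SQ; rewrite (adjoint_unique sQ).
  have -> : Q \o Q = fun x => (k / M)%:C *: B x + ((1 - r) ^+ 2)%:C *: x.
    apply/funext => x; rewrite /= QQ /Ar /A.
    have -> : (1 - r) ^+ 2 = 1 - k by rewrite /k; ring.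
    by rewrite [(k / M)%:C]rmorphM [(1 - k)%:C]rmorphB rmorph1 /=; vec_ring.
  rewrite (state_linear sphi) //; last by exact: (cstar_scale cS _ (cstar_id cS)).
  by rewrite (state_scale _ (cstar_id cS)) (state_unital sphi) mulr1 addrC.
have keyim r : 0 <= r < 1 -> (2 * r - r ^+ 2) / M * im (phi B) = 0.
  by move=> /key; rewrite lecE imD imM /= mul0r addr0 add0r => /andP[/eqP].
have keyre r : 0 <= r < 1 -> 0 <= (1 - r) ^+ 2 + (2 * r - r ^+ 2) / M * re (phi B).
  by move=> /key; rewrite lecE reD reM /= mul0r subr0 => /andP[_].
rewrite lecE /=; apply/andP; split.
  have := @keyim 2^-1 ltac:(apply/andP; split; lra).
  have -> : (2 * 2^-1 - 2^-1 ^+ 2) / M * im (phi B) = 3 / 4 * (M^-1 * im (phi B)).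
    by field; rewrite gt_eqF.
  move=> h; have {h}/eqP : M^-1 * im (phi B) = 0 by lra.
  by rewrite mulf_eq0 invr_eq0 (gt_eqF M0).
rewrite leNgt; apply/negP => neg.
pose k := - re (phi B) / M.
have k0 : 0 < k by rewrite divr_gt0 // oppr_gt0.
pose s := k / (1 + k).
have s0 : 0 < s by rewrite divr_gt0 //; lra.
have s1 : s < 1 by rewrite ltr_pdivrMr; lra.
have := @keyre (1 - s) ltac:(apply/andP; split; lra).
have -> : (2 * (1 - s) - (1 - s) ^+ 2) / M * re (phi B) = - (1 - s ^+ 2) * k.
  by rewrite /k; field; rewrite gt_eqF.
have -> : (1 - (1 - s)) ^+ 2 + - (1 - s ^+ 2) * k = s ^+ 2 * (1 + k) - k by ring.
have -> : s ^+ 2 * (1 + k) = s * k by rewrite /s; field; lra.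
have : s * k < 1 * k by rewrite ltr_pM2r.
lra.
Qed.

(** B + M is positive when M bounds the norm of B. *)
Lemma state_real B : S B -> selfadj B -> im (phi B) = 0.
Proof.
move=> SB sB; have [M M1 hM] := bounded_op_le (cstar_bounded cS SB).
have S' := cstar_linear cS M%:C (cstar_id cS) SB.
have := @state_positive_sa _ S'.
rewrite (state_linear sphi) //; last exact: (cstar_id cS).
rewrite (state_unital sphi) mulr1 => h.
have {}h : 0 <= M%:C + phi B.
  apply: h.
    by move=> x y; rewrite !(innerDl, innerDr, innerZl, innerZr) conjC_real sB.
  move=> x; rewrite ripDl ripZl rip_nm.
  have h1 := rip_le (B x) x; have h2 := hM x.
  have h3 : nm (B x) * nm x <= M * nm x * nm x by rewrite ler_wpM2r ?nm_ge0.
  have := ler_norm (- rip (B x) x); rewrite normrN; lra.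
by move: h; rewrite lecE imD /= add0r => /andP[/eqP ].
Qed.

(** The values at the two self-adjoint elements A + adjoint A and
    i A - i (adjoint A) are real. *)
Lemma state_adjoint A : S A -> phi (adjoint A) = (phi A)^*.
Proof.
move=> SA; have Sa := cstar_adjoint cS SA; have bA := cstar_bounded cS SA.
have h1 : im (1 * phi A + phi (adjoint A)) = 0.
  rewrite -(state_linear sphi) //; apply: state_real; first exact: (cstar_linear cS).
  move=> x y; rewrite !(innerDl, innerDr, innerZl, innerZr).
  by rewrite (adjoint_inner bA) (adjoint_inner' bA) rmorph1 addrC !mul1r.
have h2 : im ('i%C * phi A + phi (fun x => - 'i%C *: adjoint A x)) = 0.
  have Si := cstar_scale cS (- 'i%C) Sa.
  rewrite -(state_linear sphi) //; apply: state_real; first exact: (cstar_linear cS).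
  move=> x y; rewrite !(innerDl, innerDr, innerZl, innerZr).
  rewrite (adjoint_inner bA) (adjoint_inner' bA) addrC.
  by congr (_ * _ + _ * _); apply: complex_eq; rewrite /= ?opprK ?oppr0.
move: h1 h2; rewrite (state_scale _ Sa) !imD !imM imN reN /= => h1 h2.
by apply: complex_eq; rewrite ?reJ ?imJ; lra.
Qed.

End States.

Section StateRange.
Variables (R : realType) (H : hilbertType R) (T : H -> H).
Hypothesis bT : bounded_operator T.
Implicit Types (x y z : H).

Lemma norm1P x : `|x| = 1 <-> nm x = 1.
Proof. by rewrite nmE; split=> [/complexI|->]. Qed.

Lemma numerical_rangeE : numerical_range T = restricted_range T setT.
Proof.
by apply/seteqP; split=> [_ [x /norm1P x1 <-]|_ [x [_ x1] <-]]; exists x => //; apply/norm1P.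
Qed.

(** In the zero space the identity is zero, which excludes phi id = 1. *)
Lemma state_exists_unit phi : state (generated_cstar_algebra T) phi -> exists x : H, nm x = 1.
Proof.
move=> sphi; have cS := generated_cstar bT; apply: contrapT => noun.
have H0 x : x = 0.
  apply: contrapT => /normalize[r _ hr]; apply: noun; by exists (r%:C *: x).
have := state_unital sphi.
have -> : (@id H) = fun=> 0 by apply/funext => x; rewrite (H0 x).
by rewrite (state_zero cS sphi) => /esym/eqP; rewrite oner_eq0.
Qed.

(** Let p in W nearly minimize the distance from al = phi T to the convex set W.
    The form of X = Re (w (T - p)) + t K, where w = conj (p - al), is
    nonnegative, so the state gives - |p - al|^2 + t K >= 0, and the distance
    vanishes as t tends to 0. *)
Lemma state_range_sub_closure : state_numerical_range T `<=` closure (numerical_range T).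
Proof.
move=> _ [phi sphi <-]; have cS := generated_cstar bT.
have ST := @generated_self _ _ T.
have lT := cstar_lin cS ST.
have [x0 x01] := state_exists_unit sphi.
have [M M1 hM] := bounded_op_le bT.
rewrite numerical_rangeE; set W := restricted_range T setT.
set al := phi T.
have Wle b : W b -> nm b <= M.
  by move=> [x [_ x1] <-]; exact: inner_op_le.
pose D : set R := [set nm (b - al) ^+ 2 | b in W].
have Dinf : has_inf D.
  split; first by exists (nm (inner (T x0) x0 - al) ^+ 2), (inner (T x0) x0) => //; exists x0.
  by exists 0 => _ [b _ <-]; rewrite sqr_ge0.
pose d := inf D.
have dle b : W b -> d <= nm (b - al) ^+ 2.
  by move=> Wb; apply: ge_inf; [case: Dinf | exists b].
have d0 : d <= 0.
  pose K := (1 + 4 * M ^+ 2) / 2.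
  apply: (@le0_eps _ d K) => [|e e0]; first by rewrite /K; have := sqr_ge0 M; lra.
  pose t := Num.min e 1.
  have t0 : 0 < t by rewrite lt_min e0 ltr01.
  have t1 : t <= 1 by rewrite ge_min lexx orbT.
  have te : t <= e by rewrite ge_min lexx.
  have [_ [p Wp <-] hp] := @inf_adherent _ D (t ^+ 2) ltac:(by rewrite exprn_gt0) Dinf.
  pose w := (p - al)^*.
  have sep b : W b -> 0 <= re (w * (b - p)) + t * K.
    move=> Wb.
    have Wc : W (t%:C * b + (1 - t)%:C * p).
      by apply: toeplitz_hausdorff => //; rewrite (ltW t0).
    have := dle _ Wc.
    have -> : t%:C * b + (1 - t)%:C * p - al = (p - al) + t%:C * (b - p).
      by rewrite rmorphB rmorph1; ring.
    have -> : nm (p - al + t%:C * (b - p)) ^+ 2 =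
       nm (p - al) ^+ 2 + 2 * t * re (w * (b - p)) + t ^+ 2 * nm (b - p) ^+ 2.
      rewrite /w; move: (p - al) (b - p) => u v.
      by rewrite !nm_sqr !(reD, imD, reM, imM, reJ, imJ) /=; ring.
    have hb : nm (b - p) ^+ 2 <= 4 * M ^+ 2.
      have h : nm (b - p) <= 2 * M.
        by apply: le_trans (nmD _ _) _; rewrite nmN; have := Wle _ Wb; have := Wle _ Wp; lra.
      by have := nm_ge0 (b - p); nra.
    move=> h.
    have h2 : 0 <= t * (2 * re (w * (b - p)) + t * (1 + 4 * M ^+ 2)).
      have : t ^+ 2 * nm (b - p) ^+ 2 <= t ^+ 2 * (4 * M ^+ 2).
        by rewrite ler_wpM2l ?sqr_ge0.
      rewrite -/d in hp; lra.
    by move: h2; rewrite pmulr_rge0 // /K; lra.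
  pose c := t * K - re (w * p).
  pose X x := 2^-1%:C *: (w *: T x + (w^* *: adjoint T x + 0)) + c%:C *: x.
  have Sw := cstar_linear cS w^* (cstar_adjoint cS ST) (cstar_zero cS).
  have Sc := cstar_scale cS c%:C (cstar_id cS).
  have SX : generated_cstar_algebra T X.
    exact: (cstar_linear cS _ (cstar_linear cS w ST Sw) Sc).
  have sX : selfadj X.
    move=> x y; rewrite /X !(innerDl, innerDr, innerZl, innerZr) inner0l inner0r.
    rewrite (adjoint_inner bT) (adjoint_inner' bT) !conjC_real conjCK.
    by ring.
  have formX x : rip (X x) x = re (w * inner (T x) x) + c * nm x ^+ 2.
    rewrite /X ripDl !ripZl rip_nm; congr (_ + _).
    rewrite addr0 /rip innerDl !innerZl (adjoint_inner' bT) (innerC x).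
    by rewrite !(reD, reM, reJ, imJ); lra.
  have pX x : 0 <= rip (X x) x.
    have [->|/eqP xn0] := eqVneq x 0; first by rewrite rip0r.
    have [r r0 hr] := normalize xn0.
    have Wb : W (inner (T (r%:C *: x)) (r%:C *: x)) by exists (r%:C *: x).
    have := sep _ Wb; rewrite (linZ lT) innerZl innerZr conjC_real.
    have r2 := normalize_sqr hr.
    have -> : re (w * (r%:C * (r%:C * inner (T x) x) - p)) =
       r ^+ 2 * re (w * inner (T x) x) - re (w * p).
      by rewrite !(reD, imD, reM, imM, reN, imN) /=; ring.
    move=> h; rewrite formX -(pmulr_rge0 _ (_ : 0 < r ^+ 2)) ?exprn_gt0 //.
    rewrite mulrDr mulrCA r2 /c; lra.
  have := state_positive_sa cS sphi SX sX pX.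
  rewrite (state_linear sphi _ (cstar_linear cS w ST Sw) Sc).
  rewrite (state_scale cS sphi _ (cstar_id cS)) (state_unital sphi) mulr1.
  rewrite (state_linear sphi _ ST Sw).
  rewrite (state_linear sphi _ (cstar_adjoint cS ST) (cstar_zero cS)) (state_zero cS sphi).
  rewrite (state_adjoint cS sphi ST) addr0 -/al lecE => /andP[_].
  have -> : re (2^-1%:C * (w * al + w^* * al^*) + c%:C) = re (w * al) + c.
    by rewrite !(reD, reM, imD, imM, reJ, imJ) /=; lra.
  have -> : re (w * al) + c = t * K - nm (p - al) ^+ 2.
    by rewrite /c /w nm_sqr !(reM, reJ, imJ, reD, imD, reN, imN); ring.
  have := dle _ Wp.
  have : t * K <= e * K by rewrite ler_wpM2r // /K; have := sqr_ge0 M; lra.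
  lra.
apply/closure_nmP => e e0.
have [_ [b Wb <-] hb] := @inf_adherent _ D (e ^+ 2) ltac:(by rewrite exprn_gt0) Dinf.
exists b => //; rewrite -(@ltr_pXn2r _ 2) ?nnegrE ?nm_ge0 ?(ltW e0) //.
by move: hb; rewrite -/d; lra.
Qed.

End StateRange.

(** * Closedness of the state range *)
Section UltraLimits.
Variables (R : realType) (U : set_system nat).
Hypothesis UU : UltraFilter U.

(** A cluster point of an ultrafilter is a limit of it. *)
Lemma ultra_cvg_real (g : nat -> R) (M : R) : (forall n, `|g n| <= M) ->
  exists l : R, forall e : R, 0 < e -> U [set n | `|g n - l| < e].
Proof.
move=> gM; have UP : ProperFilter U by apply: ultra_proper.
have gU : (g @ U) [set` `[- M, M]].
  by apply: (@filterS _ U _ setT _ _ filterT) => n _ /=; have := gM n; rewrite ler_norml in_itv.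
have [l [_ hl]] := @segment_compact R (- M) M (g @ U) (fmap_proper_filter g UP) gU.
exists (l : R) => e e0; have [//|h] := in_ultra_setVsetC [set n | `|g n - (l : R)| < e] UU.
pose B := g @` (~` [set n | `|g n - (l : R)| < e]).
have gB : (g @ U) B by apply: (@filterS _ U _ _ _ _ h) => n hn; exists n.
have [y [[n /= hn <-]]] := hl B (ball l e) gB (nbhsx_ballx _ _ e0).
by rewrite /ball /= distrC => /hn.
Qed.

Lemma ultra_cvg (f : nat -> R[i]) (M : R) : (forall n, nm (f n) <= M) ->
  exists l : R[i], f @ U --> l.
Proof.
move=> fM; have UP : ProperFilter U by apply: ultra_proper.
have [a ha] := @ultra_cvg_real (fun n => re (f n)) M (fun n => le_trans (re_le _) (fM n)).
have [b hb] := @ultra_cvg_real (fun n => im (f n)) M (fun n => le_trans (im_le _) (fM n)).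
exists (Complex a b); apply/cvg_nmP => e e0.
have e2 : 0 < e / 2 by lra.
apply: filterS2 (ha _ e2) (hb _ e2) => n /= h1 h2.
apply: le_lt_trans (nm_le_reim _) _; rewrite reD imD reN imN /=; lra.
Qed.

End UltraLimits.

Section ClosedRange.
Variables (R : realType) (H : hilbertType R) (T : H -> H).
Hypothesis bT : bounded_operator T.

(** The state is the limit of the vector states of x_n along a free
    ultrafilter, where <T x_n, x_n> tends to the given point. *)
Lemma closure_sub_state_range : closure (numerical_range T) `<=` state_numerical_range T.
Proof.
move=> al /closure_nmP cl; have cS := generated_cstar bT.
have /choice[x hx] : forall n, exists x, nm x = 1 /\ nm (inner (T x) x - al) < inv_succ R n.
  move=> n; have [_ [x /norm1P x1 <-] h] := cl _ (inv_succ_gt0 R n).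
  by exists x.
have [U [UU sU]] := @ultraFilterLemma nat \oo _.
have UP : ProperFilter U by apply: ultra_proper.
pose f A n := inner (A (x n)) (x n).
pose phi A : R[i] := get [set l : R[i] | f A @ U --> l].
have hphi A : bounded_operator A -> f A @ U --> phi A.
  move=> bA; apply: (@getPex _ [set l : R[i] | f A @ U --> l]).
  have [M M1 hM] := bounded_op_le bA; apply: (@ultra_cvg _ _ UU _ M) => n.
  exact: inner_op_le (proj1 (hx n)).
have uniq A l : bounded_operator A -> f A @ U --> l -> phi A = l.
  by move=> bA hl; apply: (cvg_unique _ (hphi A bA) hl); exact: norm_hausdorff.
exists phi; last first.
  apply: uniq => //; apply/cvg_nmP => e e0; apply: sU.
  have [N hN] := inv_nat_lt e0; exists N => // n /= Nn.
  by apply: lt_trans (hN _ Nn); exact: (proj2 (hx n)).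
split.
- move=> a A B SA SB; have bA := cstar_bounded cS SA; have bB := cstar_bounded cS SB.
  apply: uniq; first exact: bounded_comb.
  have -> : f (fun x => a *: A x + B x) = (fun n => a * f A n + f B n).
    by apply/funext => n; rewrite /f innerDl innerZl.
  by apply: cvgD (hphi B bB); apply: cvgM (hphi A bA); exact: cvg_cst.
- move=> A SA; have bA := cstar_bounded cS SA.
  have bAA := bounded_comp (adjoint_bounded bA) bA.
  have /cvg_nmP h := hphi _ bAA.
  have fE n : f (adjoint A \o A) n = (nm (A (x n)) ^+ 2)%:C.
    by rewrite /f /= adjoint_inner' // inner_xx.
  set l := phi _ in h *.
  have hl e : 0 < e -> `|im l| < e /\ - e < re l.
    move=> /h/filter_ex[n] /=; rewrite fE => hn.
    have h1 := le_lt_trans (re_le _) hn; have h2 := le_lt_trans (im_le _) hn.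
    move: h1 h2; rewrite reD imD reN imN /= add0r normrN => h1 h2; split => //.
    move: h1; rewrite ltr_norml => /andP[_]; have := sqr_ge0 (nm (A (x n))); lra.
  rewrite lecE /=; apply/andP; split.
    rewrite -normr_le0; apply/ler_addgt0Pr => e e0; rewrite add0r.
    exact: ltW (proj1 (hl e e0)).
  by apply/ler_addgt0Pr => e e0; have := proj2 (hl e e0); lra.
- apply: uniq; first exact: bounded_id.
  apply/cvg_nmP => e e0; apply: (filterS _ filterT) => n _.
  by rewrite /f inner_xx (proj1 (hx n)) expr1n subrr nm0.
Qed.

Lemma state_rangeE : state_numerical_range T = closure (numerical_range T).
Proof.
by apply/seteqP; split; [exact: state_range_sub_closure | exact: closure_sub_state_range].
Qed.

End ClosedRange.

(** * Perturbation of vectors under infinite curvature *)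
Section Curvature.
Variables (R : realType) (H : hilbertType R).
Implicit Types (x y v : H) (A B : H -> H).

(** The numerical data of v = x + s t A x, where the sign s selects the side of
    the vertical axis: the real part grows like t |A x|^2 while the imaginary
    part is of order t^2. *)
Lemma test_vector A B (M s t d : R) x (v := x + (s * t)%:C *: A x) :
  real_symmetric A -> real_symmetric B -> 1 <= M -> op_le A M -> op_le B M ->
  (forall z, 0 <= rip (B z) z) -> s ^+ 2 = 1 ->
  0 < t -> t * M <= 1 / 2 ->
  d <= t ^+ 2 -> d <= 1 / 4 -> d <= t * nm (A x) ^+ 2 / 2 ->
  nm x = 1 -> `|rip (A x) x| < d -> rip (B x) x < d ->
  [/\ 1 / 2 <= nm v ^+ 2 <= 2, t * nm (A x) ^+ 2 <= s * rip (A v) v,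
      `|rip (A v) v| <= 3 * (t * M ^+ 2) & rip (B v) v <= 2 * t ^+ 2 * (1 + M ^+ 3)].
Proof.
move=> sA sB M1 hA hB pB s1 t0 tM d2 d3 dh x1 ha hb.
have M0 : 0 <= M := le_trans ler01 M1.
have ns (u : R) : `|s * u| = `|u|.
  have : `|s| ^+ 2 = 1 ^+ 2 by rewrite real_normK ?num_real // s1 expr1n.
  by move/(pexpIrn (isT : (0 < 2)%N)) => ns; rewrite normrM ns ?nnegrE ?mul1r.
have st : (s * t) ^+ 2 = t ^+ 2 by rewrite exprMn s1 mul1r.
set y := A x in v dh *; set h := nm y in dh *.
have hM : h <= M by have := hA x; rewrite x1 mulr1.
have h0 : 0 <= h by exact: nm_ge0.
have hM2 : h ^+ 2 <= M ^+ 2 by rewrite ler_pXn2r ?nnegrE.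
set a := rip (A x) x in ha; set b := rip (B x) x in hb.
pose c := rip (A y) y; pose q := rip (B y) y.
have sa : - d < s * a < d by rewrite -ltr_norml ns.
have tc : - (t * h ^+ 2 / 2) <= t ^+ 2 * (s * c) <= t * h ^+ 2 / 2.
  rewrite -ler_norml normrM (ger0_norm (sqr_ge0 t)) ns.
  have hc : `|c| <= M * h ^+ 2.
    by apply: le_trans (rip_le _ _) _; rewrite expr2 mulrA ler_wpM2r ?hA.
  apply: le_trans (ler_wpM2l (sqr_ge0 t) hc) _.
  have -> : t ^+ 2 * (M * h ^+ 2) = t * M * (t * h ^+ 2) by ring.
  by rewrite [X in _ <= X]mulrC -[2^-1]mul1r ler_wpM2r ?mulr_ge0 ?sqr_ge0 ?(ltW t0).
have qaE : s * rip (A v) v = s * a + 2 * t * h ^+ 2 + t ^+ 2 * (s * c).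
  rewrite rsym_quad // st -/a -/y rip_nm -/h -/c.
  have -> : s * (a + 2 * (s * t) * h ^+ 2 + t ^+ 2 * c) =
     s * a + s ^+ 2 * (2 * t * h ^+ 2) + t ^+ 2 * (s * c) by ring.
  by rewrite s1 mul1r.
have NE : nm v ^+ 2 = 1 + 2 * (t * (s * a)) + (t * h) ^+ 2.
  rewrite nm_sqrD x1 nmZ nmC ripZr ns (ger0_norm (ltW t0)) -/h (ripC x) -/a; ring.
have t1 : t <= 1.
  have : t * 1 <= t * M by rewrite ler_wpM2l ?(ltW t0).
  by move: tM; clear; lra.
have ta : - (1 / 4) <= t * (s * a) <= 1 / 4.
  rewrite -ler_norml normrM (ger0_norm (ltW t0)) ns -[X in _ <= X]mul1r.
  by apply: ler_pM => //; [exact: ltW | exact: ltW (lt_le_trans ha d3)].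
have th : 0 <= (t * h) ^+ 2 <= 1 / 4.
  rewrite sqr_ge0 /=; have -> : 1 / 4 = (1 / 2) ^+ 2 :> R by field.
  rewrite ler_pXn2r ?nnegrE ?mulr_ge0 ?(ltW t0) ?divr_ge0 //.
  by apply: le_trans tM; rewrite ler_wpM2l ?(ltW t0).
split.
- by rewrite NE; move: ta th; clear; lra.
- by rewrite qaE; move: sa tc dh; clear; lra.
- have thM : t * h ^+ 2 <= t * M ^+ 2 by rewrite ler_wpM2l ?(ltW t0).
  have th0 : 0 <= t * h ^+ 2 by rewrite mulr_ge0 ?sqr_ge0 ?(ltW t0).
  by rewrite -ns qaE ler_norml; move: sa tc dh thM th0; clear; lra.
  (* positivity of B at the reflected vector bounds the mixed term *)
- have := pB (x + (- (s * t))%:C *: y); rewrite rsym_quad // rsym_quad //.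
  rewrite sqrrN st -/b -/q.
  have : t ^+ 2 * q <= t ^+ 2 * M ^+ 3.
    rewrite ler_wpM2l ?sqr_ge0 //; apply: le_trans (ler_norm _) _.
    apply: le_trans (rip_le _ _) _.
    have : nm (B y) * nm y <= M * h ^+ 2 by rewrite expr2 mulrA ler_wpM2r ?hB.
    by move/le_trans; apply; rewrite exprS ler_wpM2l.
  by move: hb d2; clear; lra.
Qed.

(** A vector with |A x| >= e would give, through test_vector, a point where
    K a^2 <= b fails for the ratio K of the proof; t is chosen small enough for this
    point to be within rho of 0, and then d small compared with t^2. *)
Lemma curvature_gap A B (M s : R) :
  real_symmetric A -> real_symmetric B -> 1 <= M -> op_le A M -> op_le B M ->
  (forall x, 0 <= rip (B x) x) -> s ^+ 2 = 1 ->
  (forall K : R, exists2 rho, 0 < rho & forall v, 0 < nm v ->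
     `|rip (A v) v| < rho * nm v ^+ 2 -> rip (B v) v < rho * nm v ^+ 2 ->
     0 < s * rip (A v) v ->
     K * rip (A v) v ^+ 2 <= rip (B v) v * nm v ^+ 2) ->
  forall e, 0 < e -> exists2 d, 0 < d & forall x, nm x = 1 ->
    `|rip (A x) x| < d -> rip (B x) x < d -> nm (A x) < e /\ nm (B x) < e.
Proof.
move=> sA sB M1 hA hB pB s1 curv e e0.
have M0 : 0 < M := lt_le_trans ltr01 M1.
pose C := 1 + M ^+ 3.
have C0 : 0 < C by rewrite /C addr_gt0 // exprn_gt0.
pose K := (4 * C + 1) / e ^+ 4.
have [rho rho0 hrho] := curv K.
pose t := Num.min (Num.min 1 (1 / (2 * M))) (Num.min (rho / (12 * M ^+ 2)) (rho / (8 * C))).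
have t0 : 0 < t by rewrite !lt_min !divr_gt0 // ?mulr_gt0 ?exprn_gt0 // ltr01.
have t1 : t <= 1 by rewrite !ge_min lexx.
have tM : t * M <= 1 / 2.
  have : t <= 1 / (2 * M) by rewrite !ge_min lexx orbT.
  by rewrite ler_pdivlMr ?mulr_gt0 //; clear; lra.
have tM2 : t * M ^+ 2 <= rho / 12.
  have : t <= rho / (12 * M ^+ 2) by rewrite !ge_min lexx !orbT.
  by rewrite ler_pdivlMr ?mulr_gt0 ?exprn_gt0 //; clear; lra.
have tC : t * C <= rho / 8.
  have : t <= rho / (8 * C) by rewrite !ge_min lexx !orbT.
  by rewrite ler_pdivlMr ?mulr_gt0 //; clear; lra.
pose d := Num.min (Num.min (t * e ^+ 2 / 2) (t ^+ 2)) (Num.min (1 / 4) (e ^+ 2 / M)).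
have d0 : 0 < d by rewrite !lt_min !divr_gt0 // ?mulr_gt0 ?exprn_gt0.
have d1 : d <= t * e ^+ 2 / 2 by rewrite !ge_min lexx.
have d2 : d <= t ^+ 2 by rewrite !ge_min lexx orbT.
have d3 : d <= 1 / 4 by rewrite !ge_min lexx !orbT.
have d4 : d <= e ^+ 2 / M by rewrite !ge_min lexx !orbT.
exists d => // x x1 ha hb; split; last first.
  rewrite -(@ltr_pXn2r _ 2) ?nnegrE ?nm_ge0 ?(ltW e0) //.
  apply: le_lt_trans (psd_sqr sB pB (ltW M0) hB x) _.
  by rewrite mulrC -ltr_pdivlMr //; apply: lt_le_trans d4.
rewrite ltNge; apply/negP => he.
have he2 : e ^+ 2 <= nm (A x) ^+ 2 by rewrite ler_pXn2r ?nnegrE ?nm_ge0 ?(ltW e0).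
have dh : d <= t * nm (A x) ^+ 2 / 2.
  by apply: le_trans d1 _; rewrite ler_wpM2r ?invr_ge0 // ler_wpM2l ?(ltW t0).
have [] := test_vector sA sB M1 hA hB pB s1 t0 tM d2 d3 dh x1 ha hb.
set v := x + _; set h := nm (A x) in he he2 *.
move=> /andP[N_lo N_hi] qa_lo qa_hi qb_hi.
have th0 : 0 < t * h ^+ 2 by rewrite mulr_gt0 // (lt_le_trans _ he2) ?exprn_gt0.
have v0 : 0 < nm v.
  rewrite lt_def nm_ge0 andbT; apply/eqP => v0.
  by move: N_lo; rewrite v0 expr0n /=; clear; lra.
have rN : rho * (1 / 2) <= rho * nm v ^+ 2 by rewrite ler_wpM2l ?(ltW rho0).
have tC2 : t ^+ 2 * C <= t * C by rewrite ler_wpM2r ?(ltW C0) // expr2 ger_pMr.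
suff [] : ~ (K * rip (A v) v ^+ 2 <= rip (B v) v * nm v ^+ 2).
  apply: hrho => //.
  - by move: qa_hi tM2 rN rho0; clear; lra.
  - by move: qb_hi tC2 tC rN rho0; rewrite /C; clear; lra.
  - exact: lt_le_trans qa_lo.
apply/negP; rewrite -ltNge.
have up : rip (B v) v * nm v ^+ 2 <= 4 * t ^+ 2 * C.
  have : rip (B v) v * nm v ^+ 2 <= rip (B v) v * 2 by rewrite ler_wpM2l.
  by move: qb_hi; rewrite -/C; clear; lra.
apply: le_lt_trans up _.
have q2 : (t * h ^+ 2) ^+ 2 <= rip (A v) v ^+ 2.
  have -> : rip (A v) v ^+ 2 = (s * rip (A v) v) ^+ 2 by rewrite exprMn s1 mul1r.
  by rewrite ler_pXn2r ?nnegrE ?(ltW th0) // (le_trans (ltW th0)).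
have e4 : t ^+ 2 * e ^+ 4 <= (t * h ^+ 2) ^+ 2.
  have -> : e ^+ 4 = (e ^+ 2) ^+ 2 by rewrite -exprM.
  rewrite [(t * _) ^+ 2]exprMn ler_wpM2l ?sqr_ge0 //.
  by rewrite ler_pXn2r ?nnegrE ?sqr_ge0.
have K0 : 0 <= K.
  by rewrite divr_ge0 ?exprn_ge0 ?(ltW e0) // addr_ge0 // mulr_ge0 // ltW.
have : K * (t ^+ 2 * e ^+ 4) <= K * rip (A v) v ^+ 2.
  by rewrite ler_wpM2l //; apply: le_trans e4 q2.
apply: lt_le_trans.
have -> : K * (t ^+ 2 * e ^+ 4) = t ^+ 2 * (4 * C + 1) by rewrite /K; field; rewrite gt_eqF.
by have := exprn_gt0 2 t0; clear; lra.
Qed.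

End Curvature.

(** * Seminorms bounded below on a subspace of finite codimension *)
Section FiniteCodimension.
Variables (R : realType) (H : hilbertType R) (D : H -> R) (M : R).
Implicit Types (x y z u v : H) (L E : seq H).
Hypotheses (D_ge0 : forall x, 0 <= D x)
  (D_add : forall x y, D (x + y) <= D x + D y)
  (D_scale : forall (a : R[i]) x, D (a *: x) = nm a * D x)
  (D_le : forall x, D x <= M * nm x).

Definition orth L : set H := [set x | forall e, e \in L -> inner x e = 0].

Definition bounded_below (V : set H) :=
  exists2 c : R, 0 < c & forall x, V x -> c * nm x <= D x.

Lemma orth_subspace L : lin_subspace (orth L).
Proof.
by move=> a x y hx hy e eL; rewrite innerDl innerZl hx // hy // mulr0 addr0.
Qed.

Lemma orth_cons u L x : orth (u :: L) x <-> inner x u = 0 /\ orth L x.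
Proof.
split=> [h|[h1 h2] e].
  by split=> [|e eL]; apply: h; rewrite inE ?eqxx // eL orbT.
by rewrite inE => /orP[/eqP->|/h2].
Qed.

Lemma not_bounded_below L (k : R) : ~ bounded_below (orth L) -> 0 < k ->
  exists x, [/\ orth L x, nm x = 1 & D x < k].
Proof.
move=> nb k0; apply: contrapT => h; apply: nb; exists k => // x Lx.
have [->|/eqP x0] := eqVneq x 0; first by rewrite nm0 mulr0.
rewrite leNgt; apply/negP => lt; apply: h.
have [r r0 hr] := normalize x0.
exists (r%:C *: x); split => //; first exact: subspaceZ (@orth_subspace L) Lx.
move: hr; rewrite D_scale nmZ nmC (ger0_norm (ltW r0)) => hr.
have : r * D x < r * (k * nm x) by rewrite ltr_pM2l.
by rewrite mulrCA hr mulr1.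
Qed.

(** Take unit vectors x_n of orth L with D x_n -> 0, rotated so that a_n =
    <x_n, e> >= 0.  The combinations a_n x_m - a_m x_n are orthogonal to e, where
    D is bounded below, so they tend to 0.  This keeps a_n away from 0 and makes
    x_n a Cauchy sequence; its limit is u. *)
Lemma kernel_vector e L : bounded_below (orth (e :: L)) -> ~ bounded_below (orth L) ->
  exists u, [/\ orth L u, nm u = 1 & D u = 0].
Proof.
move=> [c c0 hc] nb.
have /choice[x hx] : forall n, exists x, [/\ orth L x, nm x = 1, D x < c / 2 * inv_succ R n
    & exists2 a : R, 0 <= a & inner x e = a%:C].
  move=> n; have [|x [Lx x1 Dx]] := @not_bounded_below L (c / 2 * inv_succ R n) nb.
    by rewrite mulr_gt0 ?inv_succ_gt0 // divr_gt0.
  have [mu [mu1 hmu]] := phase (inner x e).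
  exists (mu *: x); split.
  - exact: subspaceZ (@orth_subspace L) Lx.
  - by rewrite nmZ mu1 x1 mul1r.
  - by rewrite D_scale mu1 mul1r.
  - by exists (nm (inner x e)); rewrite ?nm_ge0 // innerZl.
have Lx n : orth L (x n) by have [] := hx n.
have x1 n : nm (x n) = 1 by have [] := hx n.
have Dx n : D (x n) < c / 2 * inv_succ R n by have [] := hx n.
have Dx2 n : D (x n) <= c / 2.
  apply: le_trans (ltW (Dx n)) _; rewrite ger_pMr ?divr_gt0 //.
  by rewrite /inv_succ invf_le1 ?ltr0n // ler1n.
have /choice[a ha] : forall n, exists a : R, 0 <= a /\ inner (x n) e = a%:C.
  by move=> n; have [_ _ _ [a a0 ?]] := hx n; exists a.
have a0 n : 0 <= a n by have [] := ha n.
have aE n : inner (x n) e = (a n)%:C by have [] := ha n.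
have aM n : a n <= nm e.
  have := inner_le (x n) e; rewrite x1 mul1r aE nmC.
  exact: le_trans (ler_norm _).
pose z m n := (a n)%:C *: x m - (a m)%:C *: x n.
have nz m n : c * nm (z m n) <= a n * D (x m) + a m * D (x n).
  apply: le_trans (hc _ _) _.
    apply/orth_cons; split.
      by rewrite /z innerBl !innerZl !aE mulrC subrr.
    rewrite /z -scaleN1r addrC; apply: orth_subspace; exact: subspaceZ (@orth_subspace L) (Lx _).
  apply: le_trans (D_add _ _) _.
  by rewrite -scaleNr !D_scale nmN !nmC !ger0_norm.
have da m n : a m - a n <= nm (z m n).
  have : nm ((a m)%:C *: x n) <= nm (z m n) + nm ((a n)%:C *: x m).
    by rewrite -[nm (z m n)]nmN opprB; apply: le_trans (nmD _ _); rewrite subrK.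
  by rewrite !nmZ !nmC !ger0_norm // !x1; lra.
have dzC m n : nm (z m n) = nm (z n m) by rewrite nmBC.
have a0p : 0 < a 0%N.
  rewrite lt_def a0 andbT; apply/eqP => a00.
  have : c * nm (x 0%N) <= D (x 0%N) by apply: hc; apply/orth_cons; rewrite aE a00.
  by rewrite x1; have := Dx2 0%N; lra.
have alo n : a 0%N / 3 <= a n.
  have h1 := nz 0%N n; have h2 := da 0%N n.
  have h3 : c * (a 0%N - a n) <= c * nm (z 0%N n) by rewrite ler_pM2l.
  have h4 : a n * D (x 0%N) <= a n * (c / 2) by rewrite ler_wpM2l.
  have h5 : a 0%N * D (x n) <= a 0%N * (c / 2) by rewrite ler_wpM2l.
  rewrite -(ler_pM2l c0); lra.
have cauchy m n : a 0%N / 3 * nm (x m - x n) <= nm e * (inv_succ R m + inv_succ R n).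
  have h1 : a n * nm (x m - x n) <= 2 * nm (z m n).
    rewrite -{1}(ger0_norm (a0 n)) -nmC -nmZ.
    have -> : (a n)%:C *: (x m - x n) = z m n + (a m - a n)%:C *: x n.
      by rewrite /z rmorphB; vec_ring.
    apply: le_trans (nmD _ _) _; rewrite nmZ nmC x1 mulr1.
    have : `|a m - a n| <= nm (z m n).
      by rewrite ler_norml lerNl opprB da {1}dzC da.
    lra.
  have h2 : a 0%N / 3 * nm (x m - x n) <= a n * nm (x m - x n) by rewrite ler_wpM2r ?nm_ge0.
  apply: le_trans h2 (le_trans h1 _).
  rewrite -(ler_pM2l c0); have := nz m n.
  have h3 : a n * D (x m) <= nm e * (c / 2 * inv_succ R m).
    by apply: ler_pM => //; exact: ltW.
  have h4 : a m * D (x n) <= nm e * (c / 2 * inv_succ R n).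
    by apply: ler_pM => //; exact: ltW.
  lra.
have ep : 0 < nm e by apply: lt_le_trans (aM 0%N).
have [|u hu] := cauchy_seq_nm (f := x).
  move=> d d0.
  have [N hN] := @inv_nat_lt R (a 0%N / 3 * d / nm e / 2) ltac:(by rewrite !divr_gt0 // mulr_gt0 // divr_gt0).
  exists N => m n /hN; rewrite !ltr_pdivlMr // => hm /hN; rewrite !ltr_pdivlMr // => hn.
  have k0 : 0 < a 0%N / 3 by rewrite divr_gt0.
  by rewrite -(ltr_pM2l k0); apply: le_lt_trans (cauchy m n) _; lra.
have app d : 0 < d -> exists n, nm (x n - u) < d /\ D (x n) < d.
  move=> d0; have [N1 h1] := hu d d0.
  have [N2 h2] := @inv_nat_lt R (d / (c / 2)) ltac:(by rewrite !divr_gt0).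
  exists (maxn N1 N2); split; first by apply: h1; rewrite leq_maxl.
  apply: lt_trans (Dx _) _.
  by rewrite mulrC -ltr_pdivlMr ?divr_gt0 //; apply: h2; rewrite leq_maxr.
exists u; split.
- move=> f fL; apply: (@nm_eq0 R R[i]); apply/eqP; rewrite eq_le nm_ge0 andbT.
  apply: (@le0_eps _ _ (nm f)) => [|d d0]; first exact: nm_ge0.
  have [n [hn _]] := app d d0.
  have -> : inner u f = - inner (x n - u) f by rewrite innerBl Lx // sub0r opprK.
  by rewrite nmN; apply: le_trans (inner_le _ _) _; rewrite ler_wpM2r ?nm_ge0 // ltW.
- apply/eqP; rewrite -subr_eq0 -normr_le0.
  apply: (@le0_eps _ _ 1) => // d d0; have [n [hn _]] := app d d0.
  rewrite mulr1 -(x1 n); have h1 := nmD (x n - u) u; have h2 := nmD (u - x n) (x n).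
  rewrite !subrK (nmBC u (x n)) in h1 h2.
  by rewrite ler_norml; apply/andP; split; lra.
- apply/eqP; rewrite eq_le D_ge0 andbT.
  apply: (@le0_eps _ _ (`|M| + 1)) => [|d d0]; first by rewrite addr_ge0.
  have [n [hn hD]] := app d d0.
  have := D_add (u - x n) (x n); rewrite subrK; have := D_le (u - x n).
  rewrite nmBC => h1 h2.
  have : M * nm (x n - u) <= `|M| * nm (x n - u) by rewrite ler_wpM2r ?nm_ge0 // ler_norm.
  have : `|M| * nm (x n - u) <= `|M| * d by rewrite ler_wpM2l // ltW.
  lra.
Qed.

(** Otherwise kernel_vector gives a second kernel vector w of orth L, orthogonal
    to u.  The combination of u and w that is orthogonal to e vanishes by the
    bound on orth (e :: L); hence <w, e> = 0, and w vanishes for the same reason. *)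
Lemma exchange e L u : bounded_below (orth (e :: L)) ->
  orth L u -> nm u = 1 -> D u = 0 -> bounded_below (orth (u :: L)).
Proof.
move=> bb Lu u1 Du; apply: contrapT => nb.
have bb' : bounded_below (orth (e :: u :: L)).
  have [c c0 hc] := bb; exists c => // x /orth_cons[h1 /orth_cons[_ h2]].
  by apply: hc; apply/orth_cons.
have [w [/orth_cons[wu Lw] w1 Dw]] := kernel_vector bb' nb.
have [c c0 hc] := bb.
have ker0 x : orth (e :: L) x -> D x = 0 -> x = 0.
  move=> /hc h D0; apply: nm_eq0; apply/eqP; rewrite eq_le nm_ge0 andbT.
  by rewrite -(ler_pM2l c0) mulr0 -D0.
pose y := inner w e *: u - inner u e *: w.
have y0 : y = 0.
  apply: ker0.
    apply/orth_cons; split; first by rewrite innerBl !innerZl mulrC subrr.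
    rewrite /y -scaleNr addrC; apply: orth_subspace => //.
    exact: subspaceZ (@orth_subspace L) Lu.
  apply/eqP; rewrite eq_le D_ge0 andbT; apply: le_trans (D_add _ _) _.
  by rewrite -scaleNr !D_scale Du Dw !mulr0 addr0.
have we : inner w e = 0.
  have := congr1 (fun v => inner v u) y0.
  by rewrite /y innerBl !innerZl wu mulr0 subr0 inner_xx u1 expr1n mulr1 inner0l.
have : w = 0 by apply: ker0 => //; apply/orth_cons.
by move=> w0; move: w1; rewrite w0 nm0 => /eqP; rewrite eq_sym oner_eq0.
Qed.

(** The projection v of x on the span of L, with L in the kernel of D; the span
    enters only through its orthogonality to orth L. *)
Definition splits L := forall x, exists v,
  [/\ D v = 0, orth L (x - v) & forall z, orth L z -> inner v z = 0].

Lemma splits_cons L u : splits L -> orth L u -> nm u = 1 -> D u = 0 -> splits (u :: L).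
Proof.
move=> sL Lu u1 Du x; have [v [Dv Lv hv]] := sL x.
exists (inner x u *: u + v); split.
- apply/eqP; rewrite eq_le D_ge0 andbT; apply: le_trans (D_add _ _) _.
  by rewrite D_scale Du Dv mulr0 addr0.
- apply/orth_cons; split.
    by rewrite innerBl innerDl innerZl inner_xx u1 expr1n mulr1 hv // addr0 subrr.
  have -> : x - (inner x u *: u + v) = - inner x u *: u + (x - v) by vec_ring.
  exact: orth_subspace.
- move=> z /orth_cons[zu Lz]; rewrite innerDl innerZl (innerC u z) zu.
  by rewrite rmorph0 mulr0 add0r hv.
Qed.

(** The vectors of E are exchanged one by one for kernel vectors. *)
Lemma bounded_below_kernel E : bounded_below (orth E) ->
  exists L, splits L /\ bounded_below (orth L).
Proof.
suff gen : forall L, splits L -> bounded_below (orth (E ++ L)) ->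
    exists L', splits L' /\ bounded_below (orth L').
  move=> bb; apply: (gen [::]); last by rewrite cats0.
  move=> x; exists 0; split => //; last by move=> z _; rewrite inner0l.
  by rewrite -(scale0r x) D_scale nm0 mul0r.
elim: E => [|e E IH] L sL /= bb; first by exists L.
have [b|nb] := pselect (bounded_below (orth (E ++ L))); first exact: (IH L).
have [u [Lu u1 Du]] := kernel_vector bb nb.
apply: (IH (u :: L)).
  by apply: splits_cons => // f fL; apply: Lu; rewrite mem_cat fL orbT.
have [c c0 hc] := exchange bb Lu u1 Du; exists c => // x hx; apply: hc.
by move=> f; rewrite inE mem_cat orbCA => hf; apply: hx; rewrite mem_cat inE.
Qed.

End FiniteCodimension.

(** * Orthonormal sequences and curvature of the range *)
Section OrthonormalSequences.
Variables (R : realType) (H : hilbertType R).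
Implicit Types (x y : H) (u : nat -> H).

Lemma orthonormal_nm1 u n : orthonormal_sequence u -> nm (u n) = 1.
Proof.
move=> /(_ n n); rewrite eqxx inner_xx => /complexI/eqP.
by rewrite sqrp_eq1 ?nm_ge0 // => /eqP.
Qed.

(** Bessel: |y|^2 minus the sum of the |<y, u_k>|^2 for k < n is |r_n|^2, where
    r_n is y made orthogonal to u_0, ..., u_(n-1); this sequence decreases, so
    its increments tend to 0. *)
Lemma orthonormal_weakly_to_zero u : orthonormal_sequence u -> weakly_to_zero u.
Proof.
move=> hu y.
pose r := fix r n := if n is m.+1 then r m - inner y (u m) *: u m else y.
have rS n : r n.+1 = r n - inner y (u n) *: u n by [].
have ru n m : (n <= m)%N -> inner (r n) (u m) = inner y (u m).
  elim: n => [//|n IH] nm'.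
  by rewrite rS innerBl innerZl hu (ltn_eqF nm') mulr0 subr0 IH // ltnW.
pose q n := nm (r n) ^+ 2.
have qS n : q n.+1 = q n - nm (inner y (u n)) ^+ 2.
  rewrite /q rS nm_sqrB nmZ (orthonormal_nm1 n hu) mulr1.
  have -> : rip (r n) (inner y (u n) *: u n) = nm (inner y (u n)) ^+ 2.
    by rewrite /rip innerZr ru // mulrC mul_conj.
  ring.
have qdec : nonincreasing_seq q.
  by apply/nonincreasing_seqP => n; rewrite qS gerBl sqr_ge0.
have /cvg_ex[l /= /cvgrPdist_lt hl] : cvgn q.
  by apply: nonincreasing_is_cvgn => //; exists 0 => _ [n _ <-]; rewrite sqr_ge0.
apply/cvg_seqP => e e0.
have [N _ hN] := hl (e ^+ 2 / 2) ltac:(by rewrite divr_gt0 // exprn_gt0).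
exists N => n Nn; rewrite subr0 innerC nm_conj.
rewrite -(@ltr_pXn2r _ 2) ?nnegrE ?nm_ge0 ?(ltW e0) //.
have := hN n Nn; have := hN n.+1 (leq_trans Nn (leqnSn _)).
by rewrite /= !ltr_norml qS => /andP[? ?] /andP[? ?]; lra.
Qed.

Lemma orthonormal_from_not_bounded_below (D : H -> R)
    (D_ge0 : forall x, 0 <= D x)
    (D_scale : forall (a : R[i]) x, D (a *: x) = nm a * D x) :
  (forall L, ~ bounded_below D (orth L)) ->
  exists u, orthonormal_sequence u /\ forall n, D (u n) < inv_succ R n.
Proof.
move=> nb.
have /choice[next hnext] : forall L : seq H, exists x,
    [/\ orth L x, nm x = 1 & D x < inv_succ R (size L)].
  by move=> L; exact: (not_bounded_below D_ge0 D_scale (nb L) (inv_succ_gt0 R (size L))).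
pose L n := iter n (fun L => next L :: L) [::].
have sL n : size (L n) = n by elim: n => //= n ->.
pose u n := next (L n).
have uL m n : (m < n)%N -> u m \in L n.
  elim: n => [//|n IH]; rewrite ltnS leq_eqVlt => /orP[/eqP->|/IH h].
    by rewrite inE eqxx.
  by rewrite inE h orbT.
have ult m n : (m < n)%N -> inner (u n) (u m) = 0.
  by move=> /uL; have [h _ _] := hnext (L n); exact: h.
exists u; split => [m n|n]; last by have [_ _] := hnext (L n); rewrite sL.
have [mn|nm'|->] := ltngtP m n.
- by rewrite innerC ult // rmorph0.
- exact: ult.
- by have [_ h _] := hnext (L n); rewrite inner_xx h expr1n.
Qed.

End OrthonormalSequences.

Section CurvatureRange.
Variables (R : realType).
Implicit Types (C E : set R[i]) (lambda omega z : R[i]).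

Lemma curvature_ratio_ge E : curvature_ratio a @[a --> within E 0^'] --> +oo%E ->
  forall K : R, exists2 rho : R, 0 < rho & forall z, E z -> nm z < rho -> re z != 0 ->
    K * re z ^+ 2 <= `|im z|.
Proof.
move=> /cvgeyPge h K; have := h K.
rewrite /within /= /dnbhs /within /= => /nbhs_nmP[rho rho0 hrho].
exists rho => // z Ez zr rez.
have z0 : z != 0 by apply: contra_neq rez => ->.
have := hrho z _ z0 Ez; rewrite subr0 => /(_ zr).
rewrite /curvature_ratio (negbTE rez) lee_fin ler_pdivlMr // lt_def sqr_ge0 andbT.
by rewrite sqrf_eq0.
Qed.

(** What both kinds of infinite curvature provide: the ratio tends to infinity
    on at least one side of the vertical axis. *)
Definition curved C lambda := exists omega (s : R), [/\ nm omega = 1, s ^+ 2 = 1,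
  rigid_motion lambda omega C `<=` [set z | 0 <= im z] &
  forall K : R, exists2 rho : R, 0 < rho & forall z, rigid_motion lambda omega C z ->
    nm z < rho -> 0 < s * re z -> K * re z ^+ 2 <= im z].

Lemma nm_eq1 (z : R[i]) : `|z| = 1 -> nm z = 1.
Proof. by rewrite nmE => /complexI. Qed.

Lemma infinite_curvature_curved C lambda : infinite_curvature C lambda -> curved C lambda.
Proof.
move=> [omega [/nm_eq1 o1 [[_ up] /curvature_ratio_ge h]]].
exists omega, 1; split => //; first by rewrite expr1n.
move=> K; have [rho rho0 hrho] := h K; exists rho => // z Dz zr.
by rewrite mul1r => rez; rewrite -[im z]ger0_norm ?hrho ?gt_eqF //; exact: up.
Qed.

Lemma infinite_one_sided_curvature_curved C lambda :
  infinite_one_sided_curvature C lambda -> curved C lambda.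
Proof.
move=> [omega [/nm_eq1 o1 [[_ up] _ [] /curvature_ratio_ge h]]].
  exists omega, (-1); split => //; first by rewrite sqrrN expr1n.
  move=> K; have [rho rho0 hrho] := h K; exists rho => // z Dz zr.
  rewrite mulN1r oppr_gt0 => rez; rewrite -[im z]ger0_norm; last exact: up.
  by rewrite hrho ?lt_eqF.
exists omega, 1; split => //; first by rewrite expr1n.
move=> K; have [rho rho0 hrho] := h K; exists rho => // z Dz zr.
rewrite mul1r => rez; rewrite -[im z]ger0_norm; last exact: up.
by rewrite hrho ?gt_eqF.
Qed.

End CurvatureRange.

Section Defect.
Variables (R : realType) (H : hilbertType R) (T : H -> H) (lambda : R[i]).
Hypothesis bT : bounded_operator T.
Implicit Types (x y : H).

(** The seminorm whose smallness along unit vectors defines reducing approximate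
    eigenvalues. *)
Definition defect x : R := nm (T x - lambda *: x) + nm (adjoint T x - lambda^* *: x).

Lemma defect_ge0 x : 0 <= defect x.
Proof. by rewrite addr_ge0 ?nm_ge0. Qed.

Lemma defect_add x y : defect (x + y) <= defect x + defect y.
Proof.
rewrite /defect (linD (bounded_lin bT)) (linD (adjoint_linear bT)) !scalerDr.
rewrite !opprD [T x + T y + _]addrACA [adjoint T x + _ + _]addrACA [X in _ <= X]addrACA.
by apply: lerD; exact: nmD.
Qed.

Lemma defect_scale (a : R[i]) x : defect (a *: x) = nm a * defect x.
Proof.
rewrite /defect (linZ (bounded_lin bT)) (linZ (adjoint_linear bT)).
by rewrite !scalerA !(mulrC _ a) -!scalerA -!scalerBr !nmZ -mulrDr.
Qed.

Lemma defect_le : exists M : R, forall x, defect x <= M * nm x.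
Proof.
have [M M1 hM] := bounded_op_le bT; exists (2 * M + 2 * nm lambda) => x.
have h1 := nmD (T x) (- (lambda *: x)); have h2 := nmD (adjoint T x) (- (lambda^* *: x)).
rewrite !nmN !nmZ nm_conj in h1 h2.
have := hM x; have := adjoint_op_le bT hM x; rewrite /defect; lra.
Qed.

Lemma defect_norm x : `|T x - lambda *: x| + `|adjoint T x - lambda^* *: x| = (defect x)%:C.
Proof. by rewrite !nmE -rmorphD. Qed.

Lemma defect_cvg0 (u : nat -> H) :
  (forall e : R, 0 < e -> exists N, forall n, (N <= n)%N -> defect (u n) < e) ->
  `|T (u n) - lambda *: u n| + `|adjoint T (u n) - lambda^* *: u n|
      @[n --> \oo] --> (0 : R[i]).
Proof.
move=> h; apply/cvg_seqP => e /h[N hN]; exists N => n /hN.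
by rewrite subr0 defect_norm nmC ger0_norm ?defect_ge0.
Qed.

(** A and B are the real and imaginary parts of omega (T - lambda), so that the
    values of their quadratic forms at v are |v|^2 times the coordinates of a
    point of the rotated range. *)
Lemma defect_gap : curved (state_numerical_range T) lambda ->
  forall e, 0 < e -> exists2 d, 0 < d & forall x, nm x = 1 ->
    nm (inner (T x) x - lambda) < d -> defect x < e.
Proof.
move=> [omega [s [om1 s1 up curv]]] e e0.
have ba := adjoint_bounded bT.
have bs (k : R[i]) : bounded_operator (fun x : H => k *: x).
  exact: (cstar_scale (@bounded_cstar R H) k (@bounded_id R H)).
pose h : R[i] := (2^-1 : R)%:C.
pose A x := (h * omega) *: T x + ((h * omega^*) *: adjoint T x +
   (- re (omega * lambda))%:C *: x).
pose B x := (h * (- 'i%C * omega)) *: T x + ((h * ('i%C * omega^*)) *: adjoint T x +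
   (- im (omega * lambda))%:C *: x).
have bA : bounded_operator A := bounded_comb _ bT (bounded_comb _ ba (bs _)).
have bB : bounded_operator B := bounded_comb _ bT (bounded_comb _ ba (bs _)).
have c1 : (- 'i%C * omega)^* = 'i%C * omega^*.
  by apply: complex_eq; rewrite !(reM, imM, reN, imN, reJ, imJ) /=; ring.
have c2 : ('i%C * omega^*)^* = - 'i%C * omega by rewrite -c1 conjCK.
have sA : real_symmetric A.
  apply: selfadj_rsym (bounded_lin bA) _ => x y.
  rewrite /A !(innerDl, innerDr, innerZl, innerZr) !conjM_real conjC_real conjCK.
  by rewrite (adjoint_inner bT) (adjoint_inner' bT); ring.
have sB : real_symmetric B.
  apply: selfadj_rsym (bounded_lin bB) _ => x y.
  rewrite /B !(innerDl, innerDr, innerZl, innerZr) !conjM_real conjC_real c1 c2.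
  by rewrite (adjoint_inner bT) (adjoint_inner' bT); ring.
have qA x : rip (A x) x = re (omega * inner (T x) x) - re (omega * lambda) * nm x ^+ 2.
  rewrite /A /rip !(innerDl, innerZl) (adjoint_inner' bT) (innerC x) inner_xx.
  by rewrite !(reD, reM, imD, imM, reJ, imJ, reN, imN) /=; field.
have qB x : rip (B x) x = im (omega * inner (T x) x) - im (omega * lambda) * nm x ^+ 2.
  rewrite /B /rip !(innerDl, innerZl) (adjoint_inner' bT) (innerC x) inner_xx.
  by rewrite !(reD, reM, imD, imM, reJ, imJ, reN, imN) /=; field.
have nmi : nm ('i%C : R[i]) = 1.
  by apply: (@pexpIrn _ 2); rewrite ?nnegrE ?nm_ge0 // nm_sqr /= expr0n expr1n add0r.
have reconT x : nm (T x - lambda *: x) <= nm (A x) + nm (B x).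
  have -> : nm (T x - lambda *: x) = nm (omega *: (T x - lambda *: x)) by rewrite nmZ om1 mul1r.
  have -> : omega *: (T x - lambda *: x) = A x + 'i%C *: B x.
    have e1 : omega = h * omega + 'i%C * (h * (- 'i%C * omega)).
      by apply: complex_eq; rewrite !(reD, reM, imD, imM, reN, imN) /=; field.
    have e2 : 0 = h * omega^* + 'i%C * (h * ('i%C * omega^*)).
      by apply: complex_eq; rewrite !(reD, reM, imD, imM, reN, imN, reJ, imJ) /=; field.
    have e3 : - (omega * lambda) = (- re (omega * lambda))%:C + 'i%C * (- im (omega * lambda))%:C.
      by apply: complex_eq; rewrite !(reD, reM, imD, imM, reN, imN) /=; ring.
    apply: vec_eq => z; rewrite /A /B !(innerDl, innerNl, innerZl).
    transitivity (omega * inner (T x) z + 0 * inner (adjoint T x) z + - (omega * lambda) * inner x z).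
      by ring.
    by rewrite {1}e1 e2 e3; ring.
  by apply: le_trans (nmD _ _) _; rewrite nmZ nmi mul1r.
have reconS x : nm (adjoint T x - lambda^* *: x) <= nm (A x) + nm (B x).
  have -> : nm (adjoint T x - lambda^* *: x) = nm (omega^* *: (adjoint T x - lambda^* *: x)).
    by rewrite nmZ nm_conj om1 mul1r.
  have -> : omega^* *: (adjoint T x - lambda^* *: x) = A x + (- 'i%C) *: B x.
    have e1 : 0 = h * omega + - 'i%C * (h * (- 'i%C * omega)).
      by apply: complex_eq; rewrite !(reD, reM, imD, imM, reN, imN) /=; field.
    have e2 : omega^* = h * omega^* + - 'i%C * (h * ('i%C * omega^*)).
      by apply: complex_eq; rewrite !(reD, reM, imD, imM, reN, imN, reJ, imJ) /=; field.
    have e3 : - (omega^* * lambda^*) = (- re (omega * lambda))%:C + - 'i%C * (- im (omega * lambda))%:C.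
      by apply: complex_eq; rewrite !(reD, reM, imD, imM, reN, imN, reJ, imJ) /=; ring.
    apply: vec_eq => z; rewrite /A /B !(innerDl, innerNl, innerZl).
    transitivity (0 * inner (T x) z + omega^* * inner (adjoint T x) z + - (omega^* * lambda^*) * inner x z).
      by ring.
    by rewrite e1 {1}e2 e3; ring.
  by apply: le_trans (nmD _ _) _; rewrite nmZ nmN nmi mul1r.
have pt v : 0 < nm v -> exists z, [/\ rigid_motion lambda omega (state_numerical_range T) z,
    rip (A v) v = nm v ^+ 2 * re z & rip (B v) v = nm v ^+ 2 * im z].
  move=> v0; have [|r r0 hr] := @normalize _ _ v.
    by move=> v00; move: v0; rewrite v00 nm0 ltxx.
  exists (omega * (inner (T (r%:C *: v)) (r%:C *: v) - lambda)).
  have r2 : nm v ^+ 2 * r ^+ 2 = 1 by rewrite mulrC; exact: normalize_sqr.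
  split.
  - exists (inner (T (r%:C *: v)) (r%:C *: v)) => //.
    apply: (closure_sub_state_range bT); apply: subset_closure.
    by exists (r%:C *: v) => //; apply/norm1P.
  - rewrite qA (linZ (bounded_lin bT)) innerZl innerZr conjC_real.
    rewrite mulrBr reD reN mulrBr; congr (_ - _); last by rewrite mulrC.
    rewrite -[LHS]mul1r -r2 -mulrA; congr (_ * _).
    by rewrite !(reM, imM) /=; ring.
  - rewrite qB (linZ (bounded_lin bT)) innerZl innerZr conjC_real.
    rewrite mulrBr imD imN mulrBr; congr (_ - _); last by rewrite mulrC.
    rewrite -[LHS]mul1r -r2 -mulrA; congr (_ * _).
    by rewrite !(reM, imM) /=; ring.
have pB x : 0 <= rip (B x) x.
  have [->|x0] := eqVneq x 0; first by rewrite rip0r.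
  have /pt[z [/up Dz _ ->]] : 0 < nm x.
    by rewrite lt_def nm_ge0 andbT; apply: contra_neq x0 => /nm_eq0.
  by rewrite mulr_ge0 ?sqr_ge0.
have [MA MA1 hA] := bounded_op_le bA; have [MB MB1 hB] := bounded_op_le bB.
have AM : MA <= MA + MB by rewrite lerDl (le_trans ler01).
have BM : MB <= MA + MB by rewrite lerDr (le_trans ler01).
have e4 : 0 < e / 4 by rewrite divr_gt0.
have [|d d0 hd] := curvature_gap sA sB (le_trans MA1 AM) (op_leW AM hA) (op_leW BM hB)
    pB s1 _ e4.
  move=> K; have [rho rho0 hrho] := curv K.
  exists (rho / 2); first by rewrite divr_gt0.
  move=> v v0; have [z [Dz -> ->]] := pt v v0; have n0 : 0 < nm v ^+ 2 by rewrite exprn_gt0.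
  rewrite normrM (ger0_norm (ltW n0)) ![nm v ^+ 2 * _]mulrC !ltr_pM2r // mulrA => h1 h2.
  rewrite pmulr_lgt0 // => h3.
  have imz : 0 <= im z by exact: up.
  have h4 : K * re z ^+ 2 <= im z.
    apply: hrho => //; apply: le_lt_trans (nm_le_reim _) _; rewrite (ger0_norm imz); lra.
  rewrite [X in X <= _](_ : _ = (nm v ^+ 2) ^+ 2 * (K * re z ^+ 2)); last by ring.
  rewrite [X in _ <= X](_ : _ = (nm v ^+ 2) ^+ 2 * im z); last by ring.
  by rewrite ler_wpM2l ?sqr_ge0.
exists d => // x x1 hx.
have E : omega * (inner (T x) x - lambda) = omega * inner (T x) x - omega * lambda by rewrite mulrBr.
have no : nm (omega * (inner (T x) x - lambda)) < d by rewrite nmM om1 mul1r.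
have [||h1 h2] := hd x x1.
- apply: le_lt_trans no; apply: le_trans (re_le _).
  by rewrite qA x1 expr1n mulr1 E reD reN.
- apply: le_lt_trans no; apply: le_trans (im_le _); apply: le_trans (ler_norm _) _.
  by rewrite qB x1 expr1n mulr1 E imD imN.
have := reconT x; have := reconS x; rewrite /defect; lra.
Qed.
End Defect.

(** * Linear vertices *)
Section PlaneConvexity.
Variable R : realType.
Implicit Types (C D : set R[i]) (a b : R[i]) (t : R).

(** This removes the real module structure of Rcomplex R from the definition. *)
Lemma convexP C : convex C <->
  forall t a b, 0 <= t <= 1 -> C a -> C b -> C (t%:C * a + (1 - t)%:C * b).
Proof.
have E (t : {i01 R}) a b : (@conv R (convex_lmodType (Rcomplex R)) t a b : R[i]) =
    (t%:num)%:C * a + (1 - t%:num)%:C * b.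
  apply: complex_eq; rewrite /conv /=; case: a => a1 a2; case: b => b1 b2 /=; rewrite /unstable.onem; ring.
split=> [h t a b t01 Ca Cb|h a b t].
  have [t' t'E] : exists t' : {i01 R}, t'%:num = t.
    have [t0 t1] := andP t01; by exists (@Itv01 R t t0 t1).
  have := h a b t'; rewrite !inE => /(_ Ca Cb).
  by rewrite E t'E.
rewrite !inE => Ca Cb; rewrite [X in C X]E; apply: h => //.
by apply/andP; split; [exact: ge0 | exact: le1].
Qed.

Lemma convex_closure C : convex C -> convex (closure C).
Proof.
move=> /convexP hC; apply/convexP => t a b /[dup] t01 /andP[t0 t1].
move=> /closure_nmP ha /closure_nmP hb; apply/closure_nmP => e e0.
have [x Cx hx] := ha _ e0; have [y Cy hy] := hb _ e0.
exists (t%:C * x + (1 - t)%:C * y); first exact: hC.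
have -> : t%:C * x + (1 - t)%:C * y - (t%:C * a + (1 - t)%:C * b) =
   t%:C * (x - a) + (1 - t)%:C * (y - b) by ring.
apply: le_lt_trans (nmD _ _) _; rewrite !nmM !nmC !ger0_norm ?subr_ge0 //.
have [tz|tn0] := eqVneq t 0; first by rewrite tz mul0r add0r subr0 mul1r.
have h1 : t * nm (x - a) < t * e by rewrite ltr_pM2l // lt_def tn0.
have h2 : (1 - t) * nm (y - b) <= (1 - t) * e by rewrite ler_wpM2l ?subr_ge0 // ltW.
lra.
Qed.

Lemma convex_hull_sub C D : convex D -> C `<=` D -> convex_hull C `<=` D.
Proof. by move=> cD CD z; apply. Qed.

(** A convex set that is the cone with apex lambda over a set away from lambda
    has a linear vertex at lambda. *)
Lemma linear_vertex_cone C C' lambda : convex C -> convex C' -> boundary C lambda ->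
  C lambda -> C' `<=` C -> ~ closure C' lambda ->
  (forall a, C a -> a = lambda \/
     exists t b, [/\ 0 <= t <= 1, C' b & a = lambda + t%:C * (b - lambda)]) ->
  linear_vertex C lambda.
Proof.
move=> cC cC' bd Cl sub ncl dec; split => //; exists C'; split => //.
apply/seteqP; split; last first.
  by apply: convex_hull_sub => // z [->|/sub].
move=> a /dec[->|[t [b [t01 C'b ->]]]] D [/convexP cD sD].
  by apply: sD; left.
have -> : lambda + t%:C * (b - lambda) = t%:C * b + (1 - t)%:C * lambda by ring.
by apply: cD => //; apply: sD; [right | left].
Qed.

End PlaneConvexity.

Section Decomposition.
Variables (R : realType) (H : hilbertType R) (T : H -> H) (lambda : R[i]) (L : seq H).
Hypotheses (bT : bounded_operator T) (sL : splits (defect T lambda) L).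
Implicit Types (x y v : H).

Lemma defect0P x : defect T lambda x = 0 -> T x = lambda *: x /\ adjoint T x = lambda^* *: x.
Proof.
rewrite /defect => /eqP; rewrite paddr_eq0 ?nm_ge0 // => /andP[/eqP h1 /eqP h2].
by split; apply/eqP; rewrite -subr_eq0; apply/eqP; exact: nm_eq0.
Qed.

(** The joint eigenvector v contributes lambda |v|^2 and has no cross terms with
    y, so the value at v + y is lambda + |y|^2 (b - lambda), where b is the value
    at y / |y|. *)
Lemma range_decomposition a : numerical_range T a -> a = lambda \/
  exists t b, [/\ 0 <= t <= 1, restricted_range T (orth L) b & a = lambda + t%:C * (b - lambda)].
Proof.
move=> [x /norm1P x1 <-]; have [v [Dv Ly hv]] := sL x.
have [y [xE vy {}Ly]] : exists y, [/\ x = v + y, inner v y = 0 & orth L y].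
  by exists (x - v); split => //; [rewrite addrC subrK | exact: hv].
have [Tv Sv] := defect0P Dv.
have yv : inner y v = 0 by rewrite innerC vy rmorph0.
have n1 : nm v ^+ 2 + nm y ^+ 2 = 1.
  by rewrite -[1](expr1n _ 2) -x1 xE nm_sqrD /rip vy /= mulr0 addr0.
have TE : inner (T x) x = lambda * (nm v ^+ 2)%:C + inner (T y) y.
  rewrite {1 2}xE (linD (bounded_lin bT)) Tv !(innerDl, innerDr) !innerZl inner_xx vy.
  by rewrite (adjoint_inner bT y v) Sv innerZr yv; ring.
have vE : nm v ^+ 2 = 1 - nm y ^+ 2 by lra.
have [y0|/eqP y0] := eqVneq y 0.
  left; rewrite TE vE y0 (lin0 (bounded_lin bT)) inner0l nm0 expr0n /= subr0; ring.
right; have [r r0 hr] := normalize y0.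
have r2 : nm y ^+ 2 * r ^+ 2 = 1 by rewrite mulrC; exact: normalize_sqr.
exists (nm y ^+ 2), (inner (T (r%:C *: y)) (r%:C *: y)); split.
- by rewrite sqr_ge0 /=; have := sqr_ge0 (nm v); lra.
- by exists (r%:C *: y) => //; split => //; exact: subspaceZ (@orth_subspace _ _ L) Ly.
- rewrite TE vE (linZ (bounded_lin bT)) innerZl innerZr conjC_real.
  have -> : lambda + (nm y ^+ 2)%:C * (r%:C * (r%:C * inner (T y) y) - lambda) =
     lambda * (1 - (nm y ^+ 2)%:C) + ((nm y ^+ 2)%:C * r%:C ^+ 2) * inner (T y) y by ring.
  by rewrite -rmorphXn -[(nm y ^+ 2)%:C * _]rmorphM /= r2 rmorphB rmorph1 mul1r.
Qed.

(** The weight and the point of the segment are limits along one ultrafilter of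
    the weights and points for approximating elements of the range. *)
Lemma closure_range_decomposition a : closure (numerical_range T) a -> a = lambda \/
  exists t b, [/\ 0 <= t <= 1, closure (restricted_range T (orth L)) b &
    a = lambda + t%:C * (b - lambda)].
Proof.
move=> /closure_nmP cl.
set W' := restricted_range T (orth L).
(* b0 provides a segment, with weight 0, for the value lambda itself *)
have [[b0 Wb0]|noW] := pselect (exists b, W' b); last first.
  left; apply/eqP; rewrite -subr_eq0; apply/eqP/(@nm_eq0 R R[i]).
  apply/eqP; rewrite eq_le nm_ge0 andbT.
  apply: (@le0_eps _ _ 1) => // e e0; have [x Wx hx] := cl e e0; rewrite mulr1.
  have [xl|[t [b [_ Wb _]]]] := range_decomposition Wx; last by case: noW; exists b.
  by rewrite nmBC -xl ltW.
right.
have /choice[f hf] : forall n, exists p : R * R[i], [/\ 0 <= p.1 <= 1, W' p.2 &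
    nm (lambda + p.1%:C * (p.2 - lambda) - a) < inv_succ R n].
  move=> n; have [x Wx hx] := cl _ (inv_succ_gt0 R n).
  have [xl|[t [b [t01 Wb xE]]]] := range_decomposition Wx.
    exists (0, b0); split => //=; first by rewrite lexx ler01.
    by rewrite mul0r addr0 -xl.
  by exists (t, b); split => //=; rewrite -xE.
have [M M1 hM] := bounded_op_le bT.
have WM b : W' b -> nm b <= M.
  by move=> [x [_ x1] <-]; exact: inner_op_le.
have [U [UU sU]] := @ultraFilterLemma nat \oo _.
have UP : ProperFilter U by apply: ultra_proper.
have t01 n : 0 <= (f n).1 <= 1 by have [] := hf n.
have Wf n : W' (f n).2 by have [] := hf n.
have [t ht] := @ultra_cvg_real R U UU (fun n => (f n).1) 1
  (fun n => ltac:(by have /andP[? ?] := t01 n; rewrite ger0_norm)).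
have [b /cvg_nmP hb] := @ultra_cvg R U UU (fun n => (f n).2) M (fun n => WM _ (Wf n)).
have app e : 0 < e -> exists n, [/\ `|(f n).1 - t| < e, nm ((f n).2 - b) < e &
    nm (lambda + (f n).1%:C * ((f n).2 - lambda) - a) < e].
  move=> e0; have [N hN] := inv_nat_lt e0.
  have UN : U [set n | (N <= n)%N] by apply: sU; exists N.
  have [n [[h1 h2] h3]] := filter_ex (filterI (filterI (ht e e0) (hb e e0)) UN).
  exists n; split => //; apply: lt_trans (hN n h3).
  by have [] := hf n.
exists t, b; split.
- apply/andP; split; apply/ler_addgt0Pr => e e0; have [n [h1 _ _]] := app e e0;
    have /andP[? ?] := t01 n; move: h1; rewrite ltr_norml => /andP[? ?]; lra.
- by apply/closure_nmP => e e0; have [n [_ h2 _]] := app e e0; exists (f n).2.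
- apply/eqP; rewrite -subr_eq0; apply/eqP/(@nm_eq0 R R[i]).
  apply/eqP; rewrite eq_le nm_ge0 andbT.
  apply: (@le0_eps _ _ (1 + 1 + (nm b + nm lambda))) => [|e e0].
    by rewrite !addr_ge0 ?nm_ge0.
  have [n [h1 h2 h3]] := app e e0; have /andP[p0 p1] := t01 n.
  move: (f n).1 (f n).2 h1 h2 h3 p0 p1 => p q h1 h2 h3 p0 p1.
  have -> : a - (lambda + t%:C * (b - lambda)) =
     - (lambda + p%:C * (q - lambda) - a) + p%:C * (q - b) + (p - t)%:C * (b - lambda).
    by rewrite [(p - t)%:C]rmorphB; ring.
  apply: le_trans (nmD _ _) _; apply: le_trans (lerD (nmD _ _) (lexx _)) _.
  rewrite nmN !nmM !nmC (ger0_norm p0).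
  rewrite [X in _ <= X](_ : _ = e + e + e * (nm b + nm lambda)); last by ring.
  apply: lerD.
    apply: lerD; first exact: ltW.
    apply: le_trans (ltW h2); rewrite ler_piMl ?nm_ge0 //.
  apply: ler_pM; rewrite ?nm_ge0 ?(ltW h1) //.
  by apply: le_trans (nmD _ _) _; rewrite nmN.
Qed.

End Decomposition.

Section Main.
Variables (R : realType) (H : hilbertType R) (T : H -> H) (lambda : R[i]).
Hypotheses (bT : bounded_operator T)
  (lambda_bd : boundary (state_numerical_range T) lambda)
  (gap : forall e, 0 < e -> exists2 d, 0 < d & forall x, nm x = 1 ->
    nm (inner (T x) x - lambda) < d -> defect T lambda x < e).

Local Notation D := (defect T lambda).
Local Notation W := (numerical_range T).

Lemma lambda_closure : closure W lambda.
Proof.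
by have [h _] := lambda_bd; move: h; rewrite (state_rangeE bT); exact: closed_closure.
Qed.

(** lambda lies in the closure of the numerical range. *)
Lemma small_defect e : 0 < e -> exists2 x, nm x = 1 & D x < e.
Proof.
move=> /gap[d d0 hd]; have /closure_nmP/(_ d d0)[_ [x /norm1P x1 <-] hx] := lambda_closure.
by exists x => //; exact: hd.
Qed.

Lemma reducing_approx : reducing_approx_eigenvalue T lambda.
Proof.
have /choice[u hu] : forall n, exists x, nm x = 1 /\ D x < inv_succ R n.
  by move=> n; have [x x1 hx] := small_defect (inv_succ_gt0 R n); exists x.
exists u; first by move=> n; apply/norm1P; exact: (proj1 (hu n)).
apply: defect_cvg0 => e /inv_nat_lt[N hN]; exists N => n /hN.
exact: lt_trans (proj2 (hu n)).
Qed.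

Lemma convex_restricted L : convex (restricted_range T (orth L)).
Proof.
apply/convexP => t a b t01; apply: toeplitz_hausdorff => //.
  exact: bounded_lin.
exact: orth_subspace.
Qed.

Lemma convex_range : convex W.
Proof.
apply/convexP => t a b t01; rewrite numerical_rangeE; apply: toeplitz_hausdorff => //.
exact: bounded_lin.
Qed.

Lemma restricted_sub L : restricted_range T (orth L) `<=` W.
Proof. by move=> _ [x [_ x1] <-]; exists x => //; apply/norm1P. Qed.

(** If lambda is not an essential reducing eigenvalue, the common kernel of
    T - lambda and its adjoint is finite-dimensional, and lambda is at positive
    distance from the numerical range of the complementary part. *)
Lemma not_essential : ~ reducing_essential_eigenvalue T lambda ->
  exists L, splits D L /\ ~ closure (restricted_range T (orth L)) lambda.
Proof.
move=> ne; have [M hM] := defect_le lambda bT.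
have [E bE] : exists E, bounded_below D (orth E).
  apply: contrapT => nb; apply: ne.
  have [|u [ou hu]] := orthonormal_from_not_bounded_below (@defect_ge0 _ _ T lambda)
      (defect_scale lambda bT).
    by move=> L bL; apply: nb; exists L.
  exists u; split.
  - by move=> n; apply/norm1P; exact: orthonormal_nm1.
  - exact: orthonormal_weakly_to_zero.
  - apply: defect_cvg0 => e /inv_nat_lt[N hN]; exists N => n /hN.
    exact: lt_trans (hu n).
have [L [sL [c c0 hc]]] := bounded_below_kernel (@defect_ge0 _ _ T lambda)
  (defect_add lambda bT) (defect_scale lambda bT) hM bE.
exists L; split => // /closure_nmP cl.
have [d d0 hd] := gap c0; have [_ [x [Lx x1] <-] /(hd x x1)] := cl d d0.
by apply/negP; rewrite -leNgt; have := hc x Lx; rewrite x1 mulr1.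
Qed.

Lemma state_linear_vertex : ~ reducing_essential_eigenvalue T lambda ->
  linear_vertex (state_numerical_range T) lambda.
Proof.
move=> /not_essential[L [sL ncl]]; rewrite (state_rangeE bT).
apply: (@linear_vertex_cone _ _ (closure (restricted_range T (orth L)))).
- exact: convex_closure convex_range.
- exact: convex_closure (@convex_restricted L).
- by rewrite -(state_rangeE bT).
- exact: lambda_closure.
- by apply: closure_subset; exact: restricted_sub.
- by move=> h; apply: ncl; exact: (@closed_closure _ (restricted_range T (orth L))).
- exact: closure_range_decomposition.
Qed.

(** lambda belongs to W itself: if all the projections v vanished, orth L would
    be the whole space and lambda would lie outside the closure of W. *)
Lemma range_linear_vertex : ~ reducing_essential_eigenvalue T lambda ->
  linear_vertex W lambda.
Proof.
move=> /not_essential[L [sL ncl]].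
apply: (@linear_vertex_cone _ _ (restricted_range T (orth L))).
- exact: convex_range.
- exact: convex_restricted.
- split; first exact: lambda_closure.
  move=> Wi; case: lambda_bd => _; apply.
  by apply: filterS Wi => z Wz; rewrite (state_rangeE bT); exact: subset_closure.
- apply: contrapT => nW; apply: ncl; apply: closure_subset lambda_closure.
  move=> _ [x /norm1P x1 <-]; exists x => //; split => //.
  have [v [Dv Lv _]] := sL x.
  have [v0|/eqP v0] := eqVneq v 0; first by move: Lv; rewrite v0 subr0.
  case: nW; have [r r0 hr] := normalize v0.
  exists (r%:C *: v); first exact/norm1P.
  have [Tv _] := defect0P Dv.
  rewrite (linZ (bounded_lin bT)) Tv scalerA mulrC -scalerA innerZl inner_xx hr.
  by rewrite expr1n mulr1.
- exact: restricted_sub.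
- exact: ncl.
- exact: range_decomposition.
Qed.

Lemma normal_essential : reducing_essential_eigenvalue T lambda ->
  normal_essential_eigenvalue T lambda.
Proof.
move=> ess; split => // u ou /cvg_seqP hu; apply/cvg_seqP => e e0.
have [d d0 hd] := gap e0; have [N hN] := hu d d0; exists N => n /hN.
have u1 := orthonormal_nm1 n ou.
rewrite !subr0 !nmE !nmC !(ger0_norm (nm_ge0 _)) => hn.
apply: le_lt_trans (hd _ u1 _); first by rewrite /defect lerDr nm_ge0.
apply: le_lt_trans hn.
have -> : inner (T (u n)) (u n) - lambda = inner (T (u n) - lambda *: u n) (u n).
  by rewrite innerBl innerZl inner_xx u1 expr1n mulr1.
by apply: le_trans (inner_le _ _) _; rewrite u1 mulr1.
Qed.

End Main.

Theorem corollary8 (R : realType) (H : hilbertType R) (T : H -> H)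
    (T_bounded : bounded_operator T)
    (W_int : (state_numerical_range T)° !=set0)
    (lambda : R[i]) (lambda_bd : boundary (state_numerical_range T) lambda) :
  [/\ infinite_curvature (state_numerical_range T) lambda \/
        infinite_one_sided_curvature (state_numerical_range T) lambda ->
      reducing_approx_eigenvalue T lambda,
      infinite_one_sided_curvature (state_numerical_range T) lambda ->
        ~ linear_vertex (state_numerical_range T) lambda ->
      reducing_essential_eigenvalue T lambda &
      infinite_curvature (state_numerical_range T) lambda ->
        ~ linear_vertex (numerical_range T) lambda ->
      normal_essential_eigenvalue T lambda].

Proof.
split.
- move=> curv; apply: reducing_approx => //; apply: defect_gap => //.
  case: curv; first exact: infinite_curvature_curved.
  exact: infinite_one_sided_curvature_curved.
- move=> /infinite_one_sided_curvature_curved curv nv; apply: contrapT => ne; apply: nv.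
  by apply: state_linear_vertex ne => //; exact: defect_gap.
- move=> /infinite_curvature_curved curv nv.
  have gap := defect_gap T_bounded curv.
  apply: normal_essential => //; apply: contrapT => ne; apply: nv.
  exact: range_linear_vertex ne.
Qed.
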